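(* Consider $\min_{x\in X}\Psi(x)=f(x)+h(x)+\chi(x)$ with optimal solution $x^*$, and suppose: (i) $f:X\to\mathbb R$ and $h:X\to\mathbb R$ are convex and, for some $L\ge \nu\mu>0$ and $M>0$, for all $x,y\in X$, $$f(x)\le f(y)+\langle\nabla f(y),x-y\rangle+\tfrac L2\|x-y\|^2,\qquad h(x)\le h(y)+\langle h'(y),x-y\rangle+M\|x-y\|,$$ where $h'(y)\in\partial h(y)$; (ii) $\chi$ is $\mu$-strongly convex; (iii) for every $\mathcal F_{k,t-1}$-measurable point $u_{k,t-1}\in X$ there is a constant $\sigma\ge0$ such that $\mathbb E[H(u_{k,t-1},\xi_{k,t})\mid\mathcal F_{k,t-1}]=h'(u_{k,t-1})\in\partial h(u_{k,t-1})$ and $\mathbb E[\|H(u_{k,t-1},\xi_{k,t})-h'(u_{k,t-1})\|_*^2\mid\mathcal F_{k,t-1}]\le\sigma^2$, where $\xi_{k,t}$ is sampled independently of $\mathcal F_{k,t-1}$; (iv) $\beta_k\ge L\gamma_k/\nu$ for all $k\ge1$; (v) for all $k\ge2$, $$\frac{\gamma_k\Bigl(\frac{W_{k,T_k}}{1-W_{k,T_k}}(\beta_k+\mu)+\beta_k\Bigr)}{\Gamma_k}\le\frac{\gamma_{k-1}(\beta_{k-1}+\mu)}{\Gamma_{k-1}(1-W_{k-1,T_{k-1}})} .$$ Let $\{\bar x_k\}$ be the sequence generated by the RF-SGS algorithm (described in the context). Set $$\beta_k=\beta=\frac{L(1-c)}{\nu},\qquad \gamma_k=\gamma=1-c,\qquad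 T_k=\left\lceil\frac{1}{c^{k/2}}\cdot\frac{(\beta+\mu)(1-c)}{c(\beta+\mu)-\beta}\right\rceil,$$ $$N=\max\left\{1,\left\lceil\frac{2\log\max\{\frac A\epsilon,1\}}{\log(\frac1c)}\right\rceil\right\},\qquad p_{k,t}=\frac{\beta+\mu}{\beta}\cdot\frac1{c^{k/2}},\qquad \theta_{k,t}=\frac{1-\frac1{1+c^{k/2}}}{1-\frac1{(1+c^{k/2})^t}},$$ where $c=\dfrac{\sqrt{L/(\mu\nu)}}{1+\sqrt{L/(\mu\nu)}}$. Then $$\mathbb E[\Psi(\bar x_N)-\Psi(x^* )]\le c^{N/2}\cdot A,$$ where $$A=\Delta_0+(\beta+\mu)(1-c)V(x_0,x^* )+\frac{2(M^2+\sigma^2)}{\nu(\beta+\mu)},\qquad \Delta_0=\Psi(\bar x_0)-\Psi(x^* ).$$ Consequently, to obtain an $\epsilon$-solution (that is, $\mathbb E[\Psi(\bar x_N)-\Psi(x^* )]\le\epsilon$), the total numbers of evaluations of $\nabla f$ and of $h'$ (the latter through the stochastic oracle $H$) are bounded, respectively, by $$\mathcal O\left(1+\sqrt{\frac L{\nu\mu}}\,\log\max\Bigl\{1,\frac A\epsilon\Bigr\}\right)\quad\text{and}\quad\mathcal O\left(\frac{AL}{\nu\mu\epsilon}+\sqrt{\frac L{\nu\mu}}\,\log\max\Bigl\{1,\frac A\epsilon\Bigr\}\right).$$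
   Context: $X\subseteq\mathbb R^n$ is a closed convex set, $f$ is a smooth convex function, $h$ is a nonsmooth convex function, and $\chi$ is a relatively simple convex function whose proximal mapping can be computed efficiently. $\epsilon>0$ is the target accuracy. $\|\cdot\|$ is an arbitrary norm on $\mathbb R^n$ with dual norm $\|\cdot\|_*$, and $\partial h(x)$ is the subdifferential of $h$ at $x$. $\chi$ is $\mu$-strongly convex if $\chi(z)\ge\chi(x)+\langle\chi'(x),z-x\rangle+\frac\mu2\|z-x\|^2$ for all $x,z\in X$ and $\chi'(x)\in\partial\chi(x)$. $\omega:X\to\mathbb R$ is a distance generating function with modulus $\nu>0$: continuously differentiable with $\langle x-z,\nabla\omega(x)-\nabla\omega(z)\rangle\ge\nu\|x-z\|^2$ for all $x,z\in X$. The Bregman distance is $V(x,z)=\omega(z)-\omega(x)-\langle\nabla\omega(x),z-x\rangle$, so $V(x,z)\ge\frac\nu2\|x-z\|^2$; it is assumed throughout that also $V(x,z)\le\frac12\|x-z\|^2$ for all $x,z\in X$. $l_f(y,u)=f(y)+\langle\nabla f(y),u-y\rangle$. First-order information on $h$ is given by a stochastic oracle returning $H(x,\xi)$ at an input point $x$, with i.i.d. random samples $\xi_{k,t}$; $\mathcal F_{k,t-1}$ denotes the $\sigma$-field generated by all oracle samples drawn before $\xi_{k,t}$. RF-SGS algorithm (run with the parameters $\beta_k,\gamma_k,T_k,p_{k,t},\theta_{k,t}$ given in the claim). Input $x_0\in X$ and an outer-iteration horizon $N\ge1$; set $\bar x_0=x_0$. For $k=1,\dots,N$: set $\underline x_k=(1-\gamma_k)\bar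 x_{k-1}+\gamma_kx_{k-1}$ and $u_{k,0}=\tilde u_{k,0}=x_{k-1}$; for $t=1,\dots,T_k$ compute $$u_{k,t}=\arg\min_{u\in X}\bigl\{l_f(\underline x_k,u)+\langle H(u_{k,t-1},\xi_{k,t}),u-u_{k,t-1}\rangle+\chi(u)+\beta_kV(x_{k-1},u)+\beta_kp_{k,t}V(u_{k,t-1},u)\bigr\},$$ $$\tilde u_{k,t}=(1-\theta_{k,t})\tilde u_{k,t-1}+\theta_{k,t}u_{k,t};$$ then set $x_k=u_{k,T_k}$, $\tilde x_k=\tilde u_{k,T_k}$, $\bar x_k=(1-\gamma_k)\bar x_{k-1}+\gamma_k\tilde x_k$. Thus $\nabla f$ is evaluated once per outer iteration $k$, and the stochastic oracle $H$ is called once per inner iteration $(k,t)$. Auxiliary sequences: $W_{k,0}=1$, $W_{k,t}=(1-w_{k,t})W_{k,t-1}$ for $t\ge1$, with $w_{k,t}=\dfrac{\beta_k+\mu}{\beta_k(1+p_{k,t})+\mu}$; $\Gamma_0=1$, $\Gamma_k=(1-\gamma_k)\Gamma_{k-1}$ for $k\ge1$.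
   Formalization: The bound on the number of evaluations of h' is stated for ε ≤ A only: for ε much larger than A it fails, since N = 1 and T_1 ≥ 3 while AL/(νμε) tends to 0 and the logarithm vanishes (x_0 is then already an ε-solution). *)

(* Defs.v *)
From HB Require Import structures.
From mathcomp Require Import all_boot all_order all_algebra.
From mathcomp Require Import all_classical all_reals all_analysis.

Set Implicit Arguments.
Unset Strict Implicit.
Unset Printing Implicit Defensive.

Import Order.TTheory GRing.Theory Num.Theory.
Import numFieldNormedType.Exports.

Local Open Scope classical_set_scope.
Local Open Scope ring_scope.

(* R^n is 'rV[R]_n with its library (product) topology.  The arbitrary norm of
   the problem is a separate function nrm; the library norm `|.| is only used
   to speak of limits, which do not depend on the norm in finite dimension.

   Functions "X -> R" are total functions on 'rV[R]_n of which only the values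
   on X matter: every notion below is relative to X. *)

Section convex_analysis.
Context {R : realType} {n : nat}.
Implicit Types (X : set 'rV[R]_n) (nrm f : 'rV[R]_n -> R)
  (gf : 'rV[R]_n -> 'rV[R]_n) (x z g : 'rV[R]_n).

Definition dotv x z : R := \sum_(i < n) x 0 i * z 0 i.

Definition is_norm nrm : Prop :=
  [/\ forall x z, nrm (x + z) <= nrm x + nrm z,
      forall (a : R) x, nrm (a *: x) = `|a| * nrm x
    & forall x, nrm x = 0 -> x = 0].

Definition dual_norm nrm g : R := sup [set dotv g x | x in [set x | nrm x <= 1]].

Definition subdifferential X f x : set 'rV[R]_n :=
  [set g | forall z, X z -> f x + dotv g (z - x) <= f z].

(* gf x is the gradient of f at x, the Frechet derivative being taken within X
   (X may have empty interior, and f is only given on X). *)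
Definition is_gradient_on X f gf : Prop :=
  forall x, X x -> forall e : R, 0 < e ->
    \forall z \near within X (nbhs x),
      `|f z - f x - dotv (gf x) (z - x)| <= e * `|z - x|.

Definition continuously_differentiable_on X f gf : Prop :=
  is_gradient_on X f gf /\ {within X, continuous gf}.

Definition strongly_convex X nrm (mu : R) f : Prop :=
  forall x z g, X x -> X z -> subdifferential X f x g ->
    f x + dotv g (z - x) + mu / 2 * nrm (z - x) ^+ 2 <= f z.

Definition distance_generating X nrm (nu : R) f gf : Prop :=
  continuously_differentiable_on X f gf /\
  forall x z, X x -> X z -> nu * nrm (x - z) ^+ 2 <= dotv (x - z) (gf x - gf z).

Definition bregman f gf x z : R := f z - f x - dotv (gf x) (z - x).

Definition linearization f gf x z : R := f x + dotv (gf x) (z - x).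

Definition is_argmin X f x : Prop := X x /\ forall z, X z -> f x <= f z.

End convex_analysis.

Section probability.
Context {R : realType} {d} {Om : measurableType d} (P : probability Om R).
Implicit Types (F : set (set Om)) (Y Z : Om -> R).

Definition borel (E : topologicalType) : set (set E) := <<s @open E >>.

Definition measurable_wrt F (E : topologicalType) (Y : Om -> E) : Prop :=
  forall B, borel B -> F (Y @^-1` B).

(* Z is a version of E[Y | F].  As usual for conditional expectations, Y need
   only be integrable on each piece of a countable F-measurable cover of Om;
   an integrable Y is covered by setT. *)
Definition is_cond_exp F Y Z : Prop :=
  [/\ measurable_wrt F Z,
      exists D : nat -> set Om,
        [/\ forall i, F (D i), \bigcup_i D i = setT
          & forall i, P.-integrable (D i) (EFin \o Y)]
    & forall A, F A -> P.-integrable A (EFin \o Y) ->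
        P.-integrable A (EFin \o Z) /\
        (\int[P]_(w in A) (Z w)%:E = \int[P]_(w in A) (Y w)%:E)%E].

Context {d'} {Xi : measurableType d'} (xi : nat -> nat -> {RV P >-> Xi}).

(* A run draws xi k t for 1 <= k <= N and 1 <= t <= T k only; nothing is
   required of xi at other indices. *)
Definition sample_index (N : nat) (T : nat -> nat) : set (nat * nat) :=
  [set i | (1 <= i.1 <= N)%N /\ (1 <= i.2 <= T i.1)%N].

Definition drawn_before (i j : nat * nat) : bool :=
  ((i.1 < j.1) || ((i.1 == j.1) && (i.2 < j.2)))%N.

(* F_{k,t-1}: the sigma-field generated by the samples drawn before xi k t. *)
Definition past (N : nat) (T : nat -> nat) (k t : nat) : set (set Om) :=
  <<s \bigcup_(i in [set i | sample_index N T i /\ drawn_before i (k, t)])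
        preimage_set_system setT (xi i.1 i.2) measurable >>.

Definition iid_samples (N : nat) (T : nat -> nat) : Prop :=
  (forall i j (B : set Xi), sample_index N T i -> sample_index N T j ->
     measurable B -> P (xi i.1 i.2 @^-1` B) = P (xi j.1 j.2 @^-1` B)) /\
  (forall (s : seq (nat * nat)) (B : nat * nat -> set Xi), uniq s ->
     (forall i, i \in s -> sample_index N T i /\ measurable (B i)) ->
     (P (\bigcap_(i in [set` s]) (xi i.1 i.2 @^-1` B i)) =
      \prod_(i <- s) P (xi i.1 i.2 @^-1` B i))%E).

Definition independent_of_past (N : nat) (T : nat -> nat) (k t : nat) : Prop :=
  forall A (B : set Xi), past N T k t A -> measurable B ->
    (P (A `&` xi k t @^-1` B) = P A * P (xi k t @^-1` B))%E.

Context {n : nat}.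

(* Joint Borel measurability of the oracle on X * Xi. *)
Definition measurable_oracle (X : set 'rV[R]_n)
    (H : 'rV[R]_n -> Xi -> 'rV[R]_n) : Prop :=
  forall i : 'I_n,
    measurable_fun
      ((X : set (g_sigma_algebraType (@open 'rV[R]_n))) `*` [set: Xi])
      (fun z : g_sigma_algebraType (@open 'rV[R]_n) * Xi => H z.1 z.2 0 i).

(* The requirements on the oracle at the sample xi k t.  The random vector
   H(u, xi k t) has conditional mean h'(u) coordinatewise. *)
Definition unbiased_bounded_variance (X : set 'rV[R]_n) (nrm : 'rV[R]_n -> R)
    (h' : 'rV[R]_n -> 'rV[R]_n) (H : 'rV[R]_n -> Xi -> 'rV[R]_n) (sigma : R)
    (N : nat) (T : nat -> nat) (k t : nat) : Prop :=
  forall u : Om -> 'rV[R]_n,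
    measurable_wrt (past N T k t) u -> (forall w, X (u w)) ->
    (forall i : 'I_n, is_cond_exp (past N T k t)
       (fun w => H (u w) (xi k t w) 0 i) (fun w => h' (u w) 0 i)) /\
    exists2 Z : Om -> R,
      is_cond_exp (past N T k t)
        (fun w => dual_norm nrm (H (u w) (xi k t w) - h' (u w)) ^+ 2) Z
      & {ae P, forall w, Z w <= sigma ^+ 2}.

End probability.

Section algorithm.
Context {R : realType}.

Definition w_coef (mu : R) (bet : nat -> R) (p : nat -> nat -> R) k t : R :=
  (bet k + mu) / (bet k * (1 + p k t) + mu).

Fixpoint W_coef (mu : R) (bet : nat -> R) (p : nat -> nat -> R) k t : R :=
  if t is t'.+1 then (1 - w_coef mu bet p k t) * W_coef mu bet p k t' else 1.

Fixpoint Gamma_coef (gam : nat -> R) k : R :=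
  if k is k'.+1 then (1 - gam k) * Gamma_coef gam k' else 1.

Context {n : nat} {Om Xi : Type}.

(* One run of the method, as processes indexed by Om:
   x k, xt k, xb k, xu k stand for x_k, x~_k, \bar x_k, \underline x_k, and
   u k t, ut k t for u_{k,t}, u~_{k,t}. *)
Record rf_sgs (X : set 'rV[R]_n) (f chi om : 'rV[R]_n -> R)
    (gf gom : 'rV[R]_n -> 'rV[R]_n) (H : 'rV[R]_n -> Xi -> 'rV[R]_n)
    (xi : nat -> nat -> Om -> Xi) (x0 : 'rV[R]_n) (N : nat)
    (bet gam : nat -> R) (T : nat -> nat) (p theta : nat -> nat -> R)
    (x xt xb xu : nat -> Om -> 'rV[R]_n)
    (u ut : nat -> nat -> Om -> 'rV[R]_n) : Prop := RfSgs {
  rf_x0 : forall w, x 0 w = x0;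
  rf_xb0 : forall w, xb 0 w = x0;
  rf_xu : forall k w, (1 <= k <= N)%N ->
    xu k w = (1 - gam k) *: xb k.-1 w + gam k *: x k.-1 w;
  rf_u0 : forall k w, (1 <= k <= N)%N -> u k 0 w = x k.-1 w;
  rf_ut0 : forall k w, (1 <= k <= N)%N -> ut k 0 w = x k.-1 w;
  rf_u : forall k t w, (1 <= k <= N)%N -> (1 <= t <= T k)%N ->
    is_argmin X
      (fun v => linearization f gf (xu k w) v
              + dotv (H (u k t.-1 w) (xi k t w)) (v - u k t.-1 w)
              + chi v
              + bet k * bregman om gom (x k.-1 w) v
              + bet k * p k t * bregman om gom (u k t.-1 w) v)
      (u k t w);
  rf_ut : forall k t w, (1 <= k <= N)%N -> (1 <= t <= T k)%N ->
    ut k t w = (1 - theta k t) *: ut k t.-1 w + theta k t *: u k t w;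
  rf_x : forall k w, (1 <= k <= N)%N -> x k w = u k (T k) w;
  rf_xt : forall k w, (1 <= k <= N)%N -> xt k w = ut k (T k) w;
  rf_xb : forall k w, (1 <= k <= N)%N ->
    xb k w = (1 - gam k) *: xb k.-1 w + gam k *: xt k w
}.

(* Evaluation counts of a run: one gradient of f per outer iteration, one
   oracle call per inner iteration. *)
Definition gradient_evaluations (N : nat) : nat := \sum_(1 <= k < N.+1) 1.

Definition oracle_evaluations (N : nat) (T : nat -> nat) : nat :=
  \sum_(1 <= k < N.+1) \sum_(1 <= t < (T k).+1) 1.

End algorithm.

(* Main.v *)
(* The prox step satisfies a three-point inequality, because the first-order
   condition of the argmin puts a subgradient of the strongly convex chi at the
   minimizer.  Averaging this inequality over an epoch with the weights W and
   theta bounds the model at the averaged point by damped sums of noise terms,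
   and a second averaging over the epochs, where (v) makes the Bregman terms
   telescope, gives the rate c^(N/2) along every run.

   It remains to take expectations.  The iterates are adapted because the argmin
   is a Lipschitz function of the linear term, and they are square-integrable
   because the growth of the model controls |u_{k,t} - x*|^2 by quantities known
   to be integrable; hence the martingale terms <delta, x* - u_{k,t-1}> are
   integrable with mean zero, and the rest of the noise is bounded by sigma. *)

Require Import Defs.
From HB Require Import structures.
From mathcomp Require Import all_boot all_order all_algebra.
From mathcomp Require Import all_classical all_reals all_analysis.
From mathcomp Require Import measurable_realfun ring lra.
Import Order.TTheory GRing.Theory Num.Theory.
Import numFieldNormedType.Exports.
Local Open Scope classical_set_scope.
Local Open Scope ring_scope.

Set Implicit Arguments.
Unset Strict Implicit.
Unset Printing Implicit Defensive.

(** * Norms on row vectors *)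

Section norms.
Context {R : realType} {n : nat}.
Implicit Types (g x y z : 'rV[R]_n) (nrm : 'rV[R]_n -> R).

(** With [r = sqrt c] and [rho_k = r^k], the prescribed [p] satisfies
    [rho_k * beta * p_k = beta + mu], so that [W_{k,t} = (1 + rho_k)^-t] and every average of the
    method is an exponential one. The prox weight [(beta + mu) / r^k] brings the noise of epoch k
    down to order r^k. Averaging over the epochs with factor c = r^2 keeps that order, which is why
    the rate is r^N = c^(N/2), and costs a factor [1 + r <= 2], which is the 2 in A. Two obstacles
    shape the rest. X may have empty interior and gradients are relative to X, so differential
    arguments take place on segments of X. Conditional expectations are only locally integrable a
    priori, so unbiasedness cannot be integrated before the iterates are known to be
    square-integrable; adaptedness, membership in X and square-integrability are therefore proved in
    one induction over the samples. *)

Lemma dotvDr g x y : dotv g (x + y) = dotv g x + dotv g y.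
Proof. by rewrite /dotv -big_split; apply: eq_bigr => i _; rewrite mxE mulrDr. Qed.

Lemma dotvDl g x y : dotv (x + y) g = dotv x g + dotv y g.
Proof. by rewrite /dotv -big_split; apply: eq_bigr => i _; rewrite mxE mulrDl. Qed.

Lemma dotvC x y : dotv x y = dotv y x.
Proof. by apply: eq_bigr => i _; rewrite mulrC. Qed.

Lemma dotvZr (a : R) g x : dotv g (a *: x) = a * dotv g x.
Proof. by rewrite /dotv mulr_sumr; apply: eq_bigr => i _; rewrite mxE mulrCA. Qed.

Lemma dotvZl (a : R) g x : dotv (a *: g) x = a * dotv g x.
Proof. by rewrite /dotv mulr_sumr; apply: eq_bigr => i _; rewrite mxE mulrA. Qed.

Lemma dotvNr g x : dotv g (- x) = - dotv g x.
Proof. by rewrite -scaleN1r dotvZr mulN1r. Qed.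

Lemma dotvNl g x : dotv (- g) x = - dotv g x.
Proof. by rewrite -scaleN1r dotvZl mulN1r. Qed.

Lemma dotvBr g x y : dotv g (x - y) = dotv g x - dotv g y.
Proof. by rewrite dotvDr dotvNr. Qed.

Lemma dotvBl g x y : dotv (x - y) g = dotv x g - dotv y g.
Proof. by rewrite dotvDl dotvNl. Qed.

Lemma coord_le_norm x i : `|x 0 i| <= `|x|.
Proof.
rewrite [leRHS]/Num.norm/= mx_normrE.
exact: (le_bigmax _ (fun i : 'I_1 * 'I_n => `|x i.1 i.2|) (0, i)).
Qed.

Lemma norm_le_coord x e : 0 <= e -> (forall i, `|x 0 i| <= e) -> `|x| <= e.
Proof.
move=> e0 xe; rewrite [leLHS]/Num.norm/= mx_normrE.
by apply/bigmax_leP; split=> // -[i j] _ /=; rewrite (ord1 i).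
Qed.

Section is_norm.
Variables (nrm : 'rV[R]_n -> R) (hn : is_norm nrm).

Lemma nrmD x y : nrm (x + y) <= nrm x + nrm y.
Proof. by case: hn. Qed.

Lemma nrmZ a x : nrm (a *: x) = `|a| * nrm x.
Proof. by case: hn. Qed.

Lemma nrm0 : nrm 0 = 0.
Proof. by rewrite -(scale0r 0) nrmZ normr0 mul0r. Qed.

Lemma nrmN x : nrm (- x) = nrm x.
Proof. by rewrite -scaleN1r nrmZ normrN1 mul1r. Qed.

Lemma nrm_distC x y : nrm (x - y) = nrm (y - x).
Proof. by rewrite -nrmN opprB. Qed.

Lemma nrm_ge0 x : 0 <= nrm x.
Proof.
have := nrmD x (- x); rewrite subrr nrm0 nrmN => ?.
lra.
Qed.

Lemma nrm_le_sum x : nrm x <= \sum_(i < n) `|x 0 i| * nrm (delta_mx 0 i).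
Proof.
rewrite {1}(row_sum_delta x).
elim/big_ind2 : _ => [|a b c d ab cd|i _]; first by rewrite nrm0.
- by rewrite (le_trans (nrmD _ _))// lerD.
- by rewrite nrmZ.
Qed.

Lemma nrm_ub : exists2 K, 0 < K & forall x, nrm x <= K * `|x|.
Proof.
exists (1 + \sum_(i < n) nrm (delta_mx 0 i)) => [|x].
  by rewrite ltr_pwDl// sumr_ge0// => i _; exact: nrm_ge0.
apply: (le_trans (nrm_le_sum x)).
rewrite mulrDl mul1r ler_wpDl// mulr_suml; apply: ler_sum => i _.
by rewrite mulrC ler_wpM2l ?nrm_ge0 ?coord_le_norm.
Qed.

Lemma nrm_continuous : continuous nrm.
Proof.
have [K K0 nK] := nrm_ub.
move=> x; apply/(@cvgrPdist_le _ _ _ (nbhs x)) => e e0.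
near=> y.
have xy : K * `|x - y| <= e.
  rewrite mulrC -ler_pdivlMr//; near: y.
  by apply: cvgr_dist_le => //; rewrite divr_gt0.
have h1 := nrmD (x - y) y; have h2 := nrmD (y - x) x.
rewrite !subrK in h1 h2; rewrite (nrm_distC y) in h2.
have := nK (x - y); rewrite ler_norml => h3.
by apply/andP; split; lra.
Unshelve. all: by end_near. Qed.

(** By compactness the continuous [nrm] attains a minimum on the unit sphere of the library norm,
    and it is positive because only 0 has norm 0. *)
Lemma nrm_lb : exists2 K, 0 < K & forall x, `|x| <= K * nrm x.
Proof.
pose S := [set x : 'rV[R]_n | `|x| = 1].
have unitS x : x != 0 -> S (`|x|^-1 *: x).
  by move=> x0; rewrite /S/= normrZ normfV normr_id mulVf ?normr_eq0.
(* The sphere is empty when n = 0. *)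
have [S0|/set0P S0] := eqVneq S set0.
  exists 1 => // x; have [->|/unitS] := eqVneq x 0; last by rewrite S0.
  by rewrite normr0 nrm0 mulr0.
have cS : compact S.
  apply: bounded_closed_compact.
    by exists 1; split=> // M M1 x /= ->; exact: ltW.
  apply: (@closed_comp _ _ (fun x : 'rV[R]_n => `|x|) [set 1]).
    by move=> x _; exact: norm_continuous.
  exact: closed_eq.
have [x xS xmin] := EVT_min_rV S0 cS (continuous_subspaceT nrm_continuous).
rewrite inE in xS.
have nx0 : 0 < nrm x.
  rewrite lt_neqAle nrm_ge0 andbT; apply/eqP => /esym nx0.
  case: hn => _ _ /(_ _ nx0) x0; move: xS; rewrite /S/= x0 normr0.
  by move/eqP; rewrite eq_sym oner_eq0.
exists (nrm x)^-1 => [|y]; first by rewrite invr_gt0.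
have [->|y0] := eqVneq y 0; first by rewrite normr0 nrm0 mulr0.
rewrite mulrC ler_pdivlMr// mulrC.
have := xmin _ (mem_set (unitS _ y0)).
rewrite nrmZ normfV normr_id ler_pdivlMl ?normr_gt0//.
by rewrite mulrC.
Qed.

Lemma dotv_le_norm g x : `|dotv g x| <= (\sum_(i < n) `|g 0 i|) * `|x|.
Proof.
rewrite (le_trans (ler_norm_sum _ _ _))// mulr_suml; apply: ler_sum => i _.
by rewrite normrM ler_wpM2l ?coord_le_norm.
Qed.

(** [sup] has a meaningless default value on unbounded sets, so every inequality for the dual norm
    rests on this bound. *)
Lemma dual_norm_has_sup g : has_sup [set dotv g x | x in [set x | nrm x <= 1]].
Proof.
have [K K0 nK] := nrm_lb.
split; first by exists (dotv g 0), 0 => //=; rewrite nrm0.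
exists ((\sum_(i < n) `|g 0 i|) * K) => _ [x /= x1 <-].
rewrite (le_trans (ler_norm _))// (le_trans (dotv_le_norm _ _))//.
rewrite ler_wpM2l ?sumr_ge0// (le_trans (nK _))//.
by rewrite -[leRHS]mulr1 ler_wpM2l// ltW.
Qed.

Lemma dotv_le_dual g x : dotv g x <= dual_norm nrm g * nrm x.
Proof.
have [nx0|nx0] := eqVneq (nrm x) 0.
  by case: hn => _ _ /(_ _ nx0) ->; rewrite -(scale0r x) dotvZr nrmZ normr0 !mul0r mulr0.
have nx : 0 < nrm x by rewrite lt_neqAle eq_sym nx0 nrm_ge0.
rewrite -ler_pdivrMr// mulrC -dotvZr.
apply: (sup_upper_bound (dual_norm_has_sup g)); exists ((nrm x)^-1 *: x) => //=.
by rewrite nrmZ normfV ger0_norm ?nrm_ge0// mulVf.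
Qed.

Lemma norm_dotv_le_dual g x : `|dotv g x| <= dual_norm nrm g * nrm x.
Proof.
rewrite ler_norml dotv_le_dual andbT lerNl -dotvNr -(nrmN x).
exact: dotv_le_dual.
Qed.

Lemma dual_norm_ge0 g : 0 <= dual_norm nrm g.
Proof.
apply: (sup_upper_bound (dual_norm_has_sup g)); exists 0 => /=.
  by rewrite nrm0.
by rewrite -(scale0r 0) dotvZr mul0r.
Qed.

Lemma dual_norm_ub :
  exists2 K, 0 < K & forall g, dual_norm nrm g <= K * `|g|.
Proof.
have [K K0 nK] := nrm_lb.
exists (n%:R * K + 1) => [|g]; first by rewrite ltr_pwDr// mulr_ge0// ltW.
rewrite mulrDl mul1r ler_wpDr//.
apply: ge_sup; first by case: (dual_norm_has_sup g).
move=> _ [x /= x1 <-].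
rewrite (le_trans (ler_norm _))// (le_trans (dotv_le_norm _ _))//.
have xK : `|x| <= K by rewrite (le_trans (nK _))// -[leRHS]mulr1 ler_wpM2l// ltW.
rewrite mulrAC ler_pM ?sumr_ge0//.
rewrite (le_trans (ler_sum _ (fun i _ => coord_le_norm g i)))//.
by rewrite sumr_const card_ord mulr_natl.
Qed.

(** Lets the variance bound, stated in the dual norm, control the coordinates, in which unbiasedness
    is stated. *)
Lemma coord_le_dual g i : `|g 0 i| <= dual_norm nrm g * nrm (delta_mx 0 i).
Proof.
suff {1}-> : g 0 i = dotv g (delta_mx 0 i) by exact: norm_dotv_le_dual.
rewrite /dotv (bigD1 i)//= mxE !eqxx mulr1 big1 ?addr0// => j ji.
by rewrite mxE (negbTE ji) mulr0.
Qed.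

End is_norm.

Lemma convex_setE (X : set 'rV[R]_n) x y t : convex_set X -> X x -> X y ->
  0 <= t <= 1 -> X ((1 - t) *: x + t *: y).
Proof.
move=> cX Xx Xy t01.
have := cX y x (Itv01 (andP t01).1 (andP t01).2) (mem_set Xy) (mem_set Xx).
by rewrite inE/= addrC.
Qed.

Lemma convex_functionE (X : set 'rV[R]_n) f x y t : convex_function X f ->
  X x -> X y -> 0 <= t <= 1 ->
  f ((1 - t) *: x + t *: y) <= (1 - t) * f x + t * f y.
Proof.
move=> cf Xx Xy t01.
have := cf (Itv01 (andP t01).1 (andP t01).2) y x (mem_set Xy) (mem_set Xx).
by rewrite /conv/= /conv/= addrC [leRHS]addrC.
Qed.

End norms.

Definition dotvE {R : realType} {n : nat} :=
  (@dotvDl R n, @dotvDr R n, @dotvNl R n, @dotvNr R n, @dotvZl R n, @dotvZr R n).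

(** * Gradients and Bregman distances *)

Section gradients.
Context {R : realType} {n : nat}.
Implicit Types (X : set 'rV[R]_n) (g x y z : 'rV[R]_n).
Variables (X : set 'rV[R]_n) (cX : convex_set X).

(** A convex X contains the segment, so a gradient relative to X is an ordinary derivative in the
    parameter, one-sided at the ends. This makes the differential arguments one-dimensional. *)
Lemma gradient_segment f gf x z : is_gradient_on X f gf -> X x -> X z ->
  forall (t e : R), 0 <= t <= 1 -> 0 < e ->
  exists2 r, 0 < r & forall s, 0 <= s <= 1 -> `|s - t| < r ->
    `|f ((1 - s) *: x + s *: z) - f ((1 - t) *: x + t *: z)
      - (s - t) * dotv (gf ((1 - t) *: x + t *: z)) (z - x)| <= e * `|s - t|.
Proof.
move=> fgf Xx Xz t e t01 e0; set y := (1 - t) *: x + t *: z.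
have Xy : X y by exact: convex_setE.
have m0 : 0 < 1 + `|z - x| by rewrite ltr_pwDl.
have /(_ (e / (1 + `|z - x|))) := fgf _ Xy.
rewrite divr_gt0// => /(_ isT) /nbhs_ballP[r /= r0 hr].
exists (r / (1 + `|z - x|)); first by rewrite divr_gt0.
move=> s s01 st.
set y' := (1 - s) *: x + s *: z.
have y'y : y' - y = (s - t) *: (z - x).
  by apply/rowP => i; rewrite !mxE; ring.
have y'yn : `|y' - y| = `|s - t| * `|z - x| by rewrite y'y normrZ.
have := hr y'; rewrite /= -ball_normE /= distrC y'yn.
have le1 : `|s - t| * `|z - x| <= `|s - t| * (1 + `|z - x|).
  by rewrite ler_wpM2l// lerDr.
move=> /(_ _ (convex_setE cX Xx Xz s01)) h.
rewrite -dotvZr -y'y; apply: (le_trans (h _)).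
  by rewrite (le_lt_trans le1)// -ltr_pdivlMr.
rewrite mulrAC -mulrA ler_wpM2l ?(ltW e0)// ler_pdivrMr//.
Qed.

(** First-order arguments need only one t for each e: divide by t, then let e vanish. *)
Lemma gradient_ray f gf x z (e : R) : is_gradient_on X f gf ->
  X x -> X z -> 0 < e ->
  exists2 t, 0 < t <= 1 &
    `|f ((1 - t) *: x + t *: z) - f x - t * dotv (gf x) (z - x)| <= e * t.
Proof.
move=> fgf Xx Xz e0.
have [|r r0 hr] := gradient_segment fgf Xx Xz (t := 0) _ e0.
  by rewrite lexx ler01.
exists (Num.min 1 (r / 2)); first by rewrite lt_min ltr01 divr_gt0//= ge_min lexx.
set t := Num.min _ _.
have t0 : 0 < t by rewrite lt_min ltr01 divr_gt0.
have := hr t; rewrite !subr0 scale1r scale0r addr0 (gtr0_norm t0).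
apply; first by rewrite ltW//= ge_min lexx.
by rewrite gt_min ltr_pdivrMr// ltr_pMr// ltr1n orbT.
Qed.

Lemma convex_gradient_le f gf x z : convex_function X f ->
  is_gradient_on X f gf -> X x -> X z -> f x + dotv (gf x) (z - x) <= f z.
Proof.
move=> cf fgf Xx Xz; apply/ler_addgt0Pr => e e0.
have [t /andP[t0 t1] ht] := gradient_ray fgf Xx Xz e0.
have := @convex_functionE _ _ X f x z t cf Xx Xz; rewrite (ltW t0) t1 => /(_ isT).
move: ht; rewrite ler_norml => /andP[h1 _] h2.
rewrite -(ler_pM2l t0); nra.
Qed.

Lemma gradient_is_derive f gf x z (t : R) : is_gradient_on X f gf ->
  X x -> X z -> 0 < t < 1 ->
  is_derive t 1 (fun s : R => f ((1 - s) *: x + s *: z))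
    (dotv (gf ((1 - t) *: x + t *: z)) (z - x)).
Proof.
move=> fgf Xx Xz /andP[t0 t1].
set phi := fun s : R => _; set D := dotv _ _.
have h : (fun h : R => h^-1 *: ((phi \o shift t) (h *: (1 : R)) - phi t)) @ 0^' --> D.
  apply/(@cvgrPdist_le _ _ _ (dnbhs (0 : R))) => e e0.
  have [|r r0 hr] := gradient_segment fgf Xx Xz (t := t) _ e0.
    by rewrite !ltW.
  near=> h.
  have h0 : h != 0 by near: h; exact: nbhs_dnbhs_neq.
  have hs : `|h| < Num.min r (Num.min t (1 - t)).
    near: h; apply: dnbhs0_lt; rewrite !lt_min r0 t0/= subr_gt0//.
  rewrite !lt_min in hs; have /and3P[hr' ht h1t] := hs.
  have := hr (h + t); rewrite addrK => /(_ _ hr').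
  have -> : 0 <= h + t <= 1 by move: ht h1t; rewrite !ltr_norml; lra.
  move=> /(_ isT) hh.
  rewrite /= distrC [h *: 1](mulr1 h).
  rewrite -(ler_pM2l (x := `|h|)) ?normr_gt0// -normrM mulrBr.
  rewrite [X in h * X](_ : _ = h^-1 * (phi (h + t) - phi t))// mulrA mulfV// mul1r.
  by rewrite [leRHS]mulrC.
split; first by apply/cvg_ex; exists D.
exact: (cvg_lim _ h).
Unshelve. all: by end_near. Qed.

Lemma gradient_within_continuous f gf x z : is_gradient_on X f gf ->
  X x -> X z ->
  {within `[0, 1], continuous (fun s : R => f ((1 - s) *: x + s *: z))}.
Proof.
move=> fgf Xx Xz; apply/subspace_continuousP => t /=.
rewrite in_itv/= => t01.
have [//|r r0 hr] := gradient_segment fgf Xx Xz (t := t) _ ltr01.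
set D := dotv _ _ in hr.
apply/cvgrPdist_le => e e0.
have D0 : 0 < 1 + `|D| by rewrite ltr_pwDl.
rewrite near_withinE; near=> s => /=; rewrite in_itv/= => s01.
have st : `|s - t| < Num.min r (e / (1 + `|D|)).
  rewrite distrC; near: s.
  by apply: cvgr_dist_lt => //; rewrite lt_min r0 divr_gt0.
move: st; rewrite lt_min ltr_pdivlMr// => /andP[sr se].
have := hr s s01 sr; rewrite mul1r => h.
rewrite distrC -(subrK ((s - t) * D) (_ - _)) (le_trans (ler_normD _ _))//.
by rewrite (le_trans _ (ltW se))// mulrDr mulr1 lerD// normrM.
Unshelve. all: by end_near. Qed.

Section bregman.
Variables (nrm : 'rV[R]_n -> R) (nu : R) (om : 'rV[R]_n -> R).
Variables (gom : 'rV[R]_n -> 'rV[R]_n).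
Hypotheses (hn : is_norm nrm) (hom : distance_generating X nrm nu om gom).

(** On the segment, subtract from [om] the quadratic that the bound predicts. Strong monotonicity of
    [gom] makes the derivative of the difference nonnegative inside, and a single use of the mean
    value theorem replaces the integration of the gradient. *)
Lemma bregman_ge x z : X x -> X z -> nu / 2 * nrm (z - x) ^+ 2 <= bregman om gom x z.
Proof.
move=> Xx Xz; have [[og _] mono] := hom.
pose q := nrm (z - x) ^+ 2; pose a := dotv (gom x) (z - x).
pose phi := fun s : R => om ((1 - s) *: x + s *: z).
pose quad := fun s : R => s * a + nu / 2 * q * s ^+ 2.
pose dphi (t : R) := dotv (gom ((1 - t) *: x + t *: z)) (z - x).
pose dquad (t : R) := a + nu * q * t.
have dq (t : R) : is_derive t (1 : R) quad (dquad t).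
  rewrite /quad; apply: is_derive_eq.
  by rewrite /dquad /GRing.scale/=; field.
have dphiq (t : R) : t \in `]0, 1[ ->
    is_derive t (1 : R) (phi - quad) (dphi t - dquad t).
  rewrite in_itv/= => t01.
  by apply: is_deriveB; apply: gradient_is_derive.
have cphiq : {within `[0, 1], continuous (phi - quad)}.
  move=> t; apply: continuousB; first exact: (gradient_within_continuous og).
  apply: continuous_subspaceT => s; apply: differentiable_continuous.
  by apply/derivable1_diffP; have [] := dq s.
have [t] := MVT ltr01 dphiq cphiq.
rewrite in_itv/= subr0 mulr1 => /andP[t0 t1].
rewrite /phi /quad /dphi /dquad /= !fctE.
rewrite subrr scale0r add0r scale1r subr0 scale1r scale0r addr0 => E.
have := mono ((1 - t) *: x + t *: z) x.
have -> : (1 - t) *: x + t *: z - x = t *: (z - x).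
  by apply/rowP => i; rewrite !mxE; ring.
rewrite (nrmZ hn) exprMn gtr0_norm// dotvZl.
have t01 : 0 <= t <= 1 by rewrite !ltW.
move=> /(_ (convex_setE cX Xx Xz t01) Xx).
rewrite dotvC dotvBl -/a -/q => hm.
have {}hm : nu * (t * q) <= dotv (gom ((1 - t) *: x + t *: z)) (z - x) - a.
  rewrite -(ler_pM2l t0); apply: le_trans hm.
  by rewrite expr2 -!mulrA mulrCA.
rewrite /bregman -/a -/q; move: E hm; rewrite expr1n expr0n/=.
set D := dotv _ _; lra.
Qed.

End bregman.
End gradients.

(** * Prox steps and epochs *)

Section prox.
Context {R : realType} {n : nat}.
Implicit Types (g x y z u v : 'rV[R]_n).
Variables (X : set 'rV[R]_n) (nrm : 'rV[R]_n -> R) (nu mu : R).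
Variables (om chi : 'rV[R]_n -> R) (gom : 'rV[R]_n -> 'rV[R]_n).
Hypotheses (cX : convex_set X) (hn : is_norm nrm) (mu0 : 0 < mu).
Hypothesis hom : distance_generating X nrm nu om gom.
Hypothesis Vle : forall y z, X y -> X z ->
  bregman om gom y z <= 1 / 2 * nrm (y - z) ^+ 2.
Hypotheses (cchi : convex_function X chi) (schi : strongly_convex X nrm mu chi).
Local Notation V := (bregman om gom).

(** Compare [u] with a point between [u] and [z]: convexity controls [chi], the gradient controls
    [om]. *)
Lemma prox_optimality (b : R) g u z : 0 <= b ->
  is_argmin X (fun v => dotv g v + chi v + b * om v) u -> X z ->
  chi u - dotv (g + b *: gom u) (z - u) + mu / 2 * nrm (z - u) ^+ 2 <= chi z.
Proof.
move=> b0 [Xu umin] Xz.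
suff sub : subdifferential X chi u (- (g + b *: gom u)).
  by have := schi Xu Xz sub; rewrite dotvNl.
move=> {Xz}z Xz; apply/ler_addgt0Pr => e e0.
(* Dividing by b + 1 instead of b covers b = 0. *)
have b1 : 0 < b + 1 by rewrite ltr_wpDl.
have e1 : 0 < e / (b + 1) by rewrite divr_gt0.
have [t /andP[t0 t1] ht] := gradient_ray cX hom.1.1 Xu Xz e1.
have t01 : 0 <= t <= 1 by rewrite ltW.
have hc := convex_functionE cchi Xu Xz t01.
have := umin _ (convex_setE cX Xu Xz t01).
rewrite (_ : dotv g ((1 - t) *: u + t *: z) = dotv g u + t * dotv g (z - u)); last first.
  by rewrite !dotvDr !dotvZr dotvNr; ring.
have be : b * (e / (b + 1)) <= e.
  by rewrite mulrCA ger_pMr// ler_pdivrMr// mul1r lerDl ler01.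
move: ht; rewrite ler_norml => /andP[_].
set c1 := om _; set D := dotv (gom u) _ => ht hm.
have {}ht : b * (c1 - om u) <= t * (b * D + e).
  have := ler_wpM2l b0 ht; have := ler_wpM2l (ltW t0) be.
  lra.
rewrite dotvNl dotvDl dotvZl -/D -(ler_pM2l t0).
lra.
Qed.

Lemma bregman_three_point x u z :
  V x z - V x u = V u z + dotv (gom u - gom x) (z - u).
Proof. by rewrite /bregman dotvBl !dotvBr; ring. Qed.

Variables (f : 'rV[R]_n -> R) (gf : 'rV[R]_n -> 'rV[R]_n).

Definition prox_objective (b q : R) y x u' g v : R :=
  linearization f gf y v + dotv g (v - u') + chi v + b * V x v + q * V u' v.

(** Up to a constant, [prox_objective] is this linear form plus [chi + (b + q) om]. The minimizer
    thus depends on all the data through one vector, and its measurability reduces to that of the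
    slope. *)
Definition prox_slope (b q : R) y x u' g : 'rV[R]_n :=
  gf y + g - b *: gom x - q *: gom u'.

Lemma prox_objective_argmin b q y x u' g u :
  is_argmin X (prox_objective b q y x u' g) u ->
  is_argmin X (fun v => dotv (prox_slope b q y x u' g) v + chi v + (b + q) * om v) u.
Proof.
move=> [Xu umin]; split=> // z /umin.
rewrite /prox_objective /prox_slope /linearization /bregman.
by rewrite !dotvE; lra.
Qed.

(** The upper bound on V enters here: it turns the strong convexity gain [mu / 2 |z - u|^2] into
    [mu V(u, z)], which joins the Bregman terms. *)
Lemma prox_three_point b q y x u' g u z : 0 <= b -> 0 <= q ->
  is_argmin X (prox_objective b q y x u' g) u -> X z ->
  prox_objective b q y x u' g u + (mu + b + q) * V u z
  <= prox_objective b q y x u' g z.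
Proof.
move=> b0 q0 umin Xz; have Xu := umin.1.
have bq : 0 <= b + q by rewrite addr_ge0.
have := prox_optimality bq (prox_objective_argmin umin) Xz.
have := ler_wpM2l (ltW mu0) (Vle Xu Xz); rewrite (nrm_distC hn).
rewrite /prox_objective /linearization /prox_slope.
have := bregman_three_point x u z; have := bregman_three_point u' u z.
rewrite !dotvE; move: (V u z) (V x z) (V x u) (V u' z) (V u' u).
by move=> Vuz Vxz Vxu Vu'z Vu'u E1 E2; rewrite -[Vu'z](subrK Vu'u) E1 -[Vxz](subrK Vxu) E2; lra.
Qed.

(** Each optimality inequality is tested at the other minimizer; in the sum [chi] cancels and the
    [om] part has a sign by monotonicity. This yields measurability of the argmin without any
    measurable selection. *)
Lemma prox_lipschitz (b : R) g1 g2 u1 u2 : 0 <= b -> 0 <= nu ->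
  is_argmin X (fun v => dotv g1 v + chi v + b * om v) u1 ->
  is_argmin X (fun v => dotv g2 v + chi v + b * om v) u2 ->
  mu * nrm (u1 - u2) <= dual_norm nrm (g1 - g2).
Proof.
move=> b0 nu0 m1 m2; have [X1 X2] := (m1.1, m2.1).
have [->|d0] := eqVneq (nrm (u1 - u2)) 0; first by rewrite mulr0 dual_norm_ge0.
have d1 : 0 < nrm (u1 - u2) by rewrite lt_neqAle eq_sym d0 nrm_ge0.
have h1 := prox_optimality b0 m1 X2; have h2 := prox_optimality b0 m2 X1.
rewrite (nrm_distC hn u2) in h1.
rewrite -(ler_pM2r d1) -mulrA -expr2.
have h3 : 0 <= b * dotv (u1 - u2) (gom u1 - gom u2).
  rewrite mulr_ge0// (le_trans _ (hom.2 _ _ X1 X2))//.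
  by rewrite mulr_ge0// exprn_ge0// nrm_ge0.
have := dotv_le_dual hn (g1 - g2) (- (u1 - u2)); rewrite (nrmN hn).
move: h1 h2 h3; rewrite (dotvC (u1 - u2)).
rewrite !dotvE; lra.
Qed.

End prox.

(** * The composite problem: inner steps, outer steps and epochs *)

Record composite_problem {R : realType} {n : nat} (X : set 'rV[R]_n)
    (nrm : 'rV[R]_n -> R) (nu mu L M : R) (om f h chi : 'rV[R]_n -> R)
    (gom gf h' : 'rV[R]_n -> 'rV[R]_n) : Prop := CompositeProblem {
  cp_convex_set : convex_set X;
  cp_norm : is_norm nrm;
  cp_nu : 0 < nu;
  cp_mu : 0 < mu;
  cp_L : 0 < L;
  cp_om : distance_generating X nrm nu om gom;
  cp_bregman_le : forall y z, X y -> X z ->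
    bregman om gom y z <= 1 / 2 * nrm (y - z) ^+ 2;
  cp_f : convex_function X f;
  cp_gf : continuously_differentiable_on X f gf;
  cp_f_smooth : forall y z, X y -> X z ->
    f z <= f y + dotv (gf y) (z - y) + L / 2 * nrm (z - y) ^+ 2;
  cp_h : convex_function X h;
  cp_h' : forall y, X y -> subdifferential X h y (h' y);
  cp_h_lipschitz : forall y z, X y -> X z ->
    h z <= h y + dotv (h' y) (z - y) + M * nrm (z - y);
  cp_chi : convex_function X chi;
  cp_chi_strong : strongly_convex X nrm mu chi
}.

(** The sum of w (1 - w)^(t - s) e_s over 1 <= s <= t, of total weight 1 - (1 - w)^t. Noise
    accumulates in this form both inside an epoch and across epochs. *)
Fixpoint damped {R : realType} (w : R) (e : nat -> R) (t : nat) : R :=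
  if t is t'.+1 then (1 - w) * damped w e t' + w * e t'.+1 else 0.

Section composite.
Context {R : realType} {n : nat}.
Implicit Types (g x y z u v : 'rV[R]_n).
Variables (X : set 'rV[R]_n) (nrm : 'rV[R]_n -> R) (nu mu L M : R).
Variables (om f h chi : 'rV[R]_n -> R) (gom gf h' : 'rV[R]_n -> 'rV[R]_n).
Hypothesis pb : composite_problem X nrm nu mu L M om f h chi gom gf h'.
Let cX := cp_convex_set pb.
Let hn := cp_norm pb.
Let nu0 := cp_nu pb.
Let mu0 := cp_mu pb.
Let L0 := cp_L pb.
Let hom := cp_om pb.
Let Vle := cp_bregman_le pb.
Let cf := cp_f pb.
Let fgf := (cp_gf pb).1.
Let fL := cp_f_smooth pb.
Let ch := cp_h pb.
Let hsub := cp_h' pb.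
Let hM := cp_h_lipschitz pb.
Let cchi := cp_chi pb.
Let schi := cp_chi_strong pb.
Local Notation V := (bregman om gom).
Local Notation Psi := (fun z => f z + h z + chi z).

Lemma bregman_ge0 x z : X x -> X z -> 0 <= V x z.
Proof.
move=> Xx Xz; apply: le_trans (bregman_ge cX hn hom Xx Xz).
by rewrite mulr_ge0 ?exprn_ge0 ?(nrm_ge0 hn)// divr_ge0// ltW.
Qed.

(** What the epoch minimizes approximately: f is replaced by its linearization at [y], while h is
    kept exactly. *)
Definition inner_model (b : R) y x v : R :=
  linearization f gf y v + h v + chi v + b * V x v.

Lemma inner_model_convex b y x v w t : 0 <= b -> X v -> X w -> 0 <= t <= 1 ->
  inner_model b y x ((1 - t) *: v + t *: w)
  <= (1 - t) * inner_model b y x v + t * inner_model b y x w.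
Proof.
move=> b0 Xv Xw t01; have Xm := convex_setE cX Xv Xw t01.
have := convex_functionE ch Xv Xw t01; have := convex_functionE cchi Xv Xw t01.
(* Weighted by 1 - t and t, the gradient terms at the intermediate point cancel, which leaves
   convexity of [om]. *)
have := bregman_ge0 Xm Xv; have := bregman_ge0 Xm Xw.
move: t01 => /andP[t0]; rewrite -subr_ge0 => t1.
rewrite /inner_model /linearization /bregman.
move: (f y) (om ((1 - t) *: v + t *: w)) (h _) (chi _) => fy omm hm chim.
rewrite !dotvE => h1 h2.
have {h1}h1 := mulr_ge0 t0 h1; have {h2}h2 := mulr_ge0 t1 h2.
have h3 := mulr_ge0 b0 (addr_ge0 h1 h2).
lra.
Qed.

(** Young's inequality followed by (M + D)^2 <= 2 (M^2 + D^2); the two squares in the proof are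
    their defects. *)
Lemma noise_young (q m D : R) : 0 < q ->
  (M + D) * m <= q * (nu / 2 * m ^+ 2) + (M ^+ 2 + D ^+ 2) / (nu * q).
Proof.
move=> q0; have nq : 0 < nu * q by rewrite mulr_gt0.
rewrite -subr_ge0 -(pmulr_rge0 _ nq).
have -> : nu * q * (q * (nu / 2 * m ^+ 2) + (M ^+ 2 + D ^+ 2) / (nu * q) - (M + D) * m)
  = ((nu * q * m - (M + D)) ^+ 2 + (M - D) ^+ 2) / 2.
  by field; rewrite !gt_eqF.
by rewrite divr_ge0// addr_ge0// sqr_ge0.
Qed.

(** Replacing the oracle's linear model by h costs M |u - u'| plus the noise paired with u - u'. The
    term [q * V u' u] absorbs both through [noise_young]. The noise paired with z - u' is left as it
    is, since it will have mean zero. *)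
Lemma inner_step b q y x u' g u z : 0 <= b -> 0 < q -> X u' -> X z ->
  is_argmin X (prox_objective om chi gom f gf b q y x u' g) u ->
  inner_model b y x u + (mu + b + q) * V u z
  <= inner_model b y x z + q * V u' z + dotv (g - h' u') (z - u')
     + (M ^+ 2 + dual_norm nrm (g - h' u') ^+ 2) / (nu * q).
Proof.
move=> b0 q0 Xu' Xz umin; have Xu := umin.1.
have h1 := prox_three_point cX hn mu0 hom Vle cchi schi b0 (ltW q0) umin Xz.
have h2 := hM Xu' Xu; have h3 := hsub Xu' Xz.
have h4 := ler_wpM2l (ltW q0) (bregman_ge cX hn hom Xu' Xu).
have h5 := noise_young (nrm (u - u')) (dual_norm nrm (g - h' u')) q0.
have h6 := dotv_le_dual hn (g - h' u') (- (u - u')); rewrite (nrmN hn) in h6.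
move: h1 h2 h3 h6; rewrite /inner_model /prox_objective.
rewrite -(subrK (h' u') g) ![dotv (g - h' u' + h' u') _]dotvDl subrK.
set d := g - h' u'.
rewrite !(dotvBr, dotvNr); lra.
Qed.

(** The new average and the linearization point differ by gam (xt - x), so the smoothness error
    carries gam^2 L / 2; the condition on b lets the term b V of the model pay for it. *)
Lemma outer_step b (gam : R) xb x xt : 0 <= b -> 0 <= gam <= 1 -> L * gam / nu <= b ->
  X xb -> X x -> X xt ->
  Psi ((1 - gam) *: xb + gam *: xt)
  <= (1 - gam) * Psi xb + gam * inner_model b ((1 - gam) *: xb + gam *: x) x xt.
Proof.
move=> b0 g01 gb Xxb Xx Xxt; have [g0 g1] := andP g01.
set y := (1 - gam) *: xb + gam *: x.
have Xy : X y by exact: convex_setE.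
have Xm := convex_setE cX Xxb Xxt g01; set m := (1 - gam) *: xb + gam *: xt in Xm *.
have h1 := fL Xy Xm.
have h2 := convex_functionE ch Xxb Xxt g01; have h3 := convex_functionE cchi Xxb Xxt g01.
have h4 := convex_gradient_le cX cf fgf Xy Xxb.
have h5 : L / 2 * nrm (m - y) ^+ 2 <= gam * (b * V x xt).
  have -> : m - y = gam *: (xt - x) by apply/rowP => i; rewrite !mxE; ring.
  rewrite (nrmZ hn) ger0_norm// exprMn.
  have h6 := bregman_ge cX hn hom Xx Xxt.
  have {}h6 := ler_wpM2l b0 h6.
  have : L * gam * (nrm (xt - x) ^+ 2) <= b * nu * (nrm (xt - x) ^+ 2).
    by rewrite ler_wpM2r ?exprn_ge0 ?(nrm_ge0 hn)// -ler_pdivrMr.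
  move=> /(ler_wpM2l g0); have := ler_wpM2l g0 h6; lra.
have h6 : dotv (gf y) (m - y) = (1 - gam) * dotv (gf y) (xb - y) + gam * dotv (gf y) (xt - y).
  by rewrite -!dotvZr -dotvDr; congr dotv; apply/rowP => i; rewrite !mxE; ring.
rewrite -/m in h2 h3; rewrite h6 in h1.
have h7 : 0 <= 1 - gam by rewrite subr_ge0.
have {h4}h4 := ler_wpM2l h7 h4.
rewrite /inner_model /linearization; lra.
Qed.

Lemma inner_model_le b y x z : X y -> X z ->
  inner_model b y x z <= Psi z + b * V x z.
Proof.
move=> Xy Xz; have := convex_gradient_le cX cf fgf Xy Xz.
rewrite /inner_model /linearization; lra.
Qed.

(* Convexity of the model on the segment from z to u, where its value at distance
   lam is bounded below by optimality of z: the coefficient L * lam of |u - z|^2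
   can thus be made small enough to be absorbed by the prox term. *)
Lemma inner_model_growth b y x u z (lam : R) : 0 <= b -> 0 < lam <= 1 ->
  X y -> X x -> X u -> is_argmin X Psi z ->
  - (L / lam * nrm (y - z) ^+ 2 + L * lam * nrm (u - z) ^+ 2
     + b / (2 * lam) * nrm (x - z) ^+ 2)
  <= inner_model b y x u - inner_model b y x z.
Proof.
move=> b0 /andP[l0 l1] Xy Xx Xu [Xz zmin].
have l01 : 0 <= lam <= 1 by rewrite (ltW l0).
have Xm := convex_setE cX Xz Xu l01.
have h1 := inner_model_convex y x b0 Xz Xu l01.
have h2 := inner_model_le b x Xy Xz.
have h3 := ler_wpM2l b0 (Vle Xx Xz).
have h4 := fL Xy Xm; have h5 := zmin _ Xm.
have h6 := mulr_ge0 b0 (bregman_ge0 Xx Xm).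
set m := (1 - lam) *: z + lam *: u in Xm h1 h4 h5 h6.
have h7 : nrm (m - y) <= nrm (y - z) + lam * nrm (u - z).
  have -> : m - y = (z - y) + lam *: (u - z) by apply/rowP => i; rewrite !mxE; ring.
  by rewrite (le_trans (nrmD hn _ _))// (nrm_distC hn z) (nrmZ hn) gtr0_norm.
have h8 : nrm (m - y) ^+ 2 <= 2 * nrm (y - z) ^+ 2 + 2 * lam ^+ 2 * nrm (u - z) ^+ 2.
  have := sqr_ge0 (nrm (y - z) - lam * nrm (u - z)).
  have : nrm (m - y) ^+ 2 <= (nrm (y - z) + lam * nrm (u - z)) ^+ 2.
    by rewrite ler_sqr// nnegrE ?addr_ge0 ?mulr_ge0 ?(nrm_ge0 hn)// ltW.
  rewrite !expr2; lra.
have h9 : 0 <= L / 2 by rewrite divr_ge0// ltW.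
have {h8}h8 := ler_wpM2l h9 h8.
rewrite -(ler_pM2l l0).
have -> : lam * - (L / lam * nrm (y - z) ^+ 2 + L * lam * nrm (u - z) ^+ 2
     + b / (2 * lam) * nrm (x - z) ^+ 2) =
   - (L * nrm (y - z) ^+ 2 + L * lam ^+ 2 * nrm (u - z) ^+ 2
     + b / 2 * nrm (x - z) ^+ 2).
  by field; rewrite gt_eqF.
rewrite mulrBr; move: h1 h2 h3 h4 h5 h6 h8.
rewrite /inner_model /linearization; move: (V x z) (V x m) => Vxz Vxm; lra.
Qed.

(** [K] is chosen before the points, so this deterministic bound carries square-integrability from
    the data of a prox step to its result. *)
Lemma inner_iterate_bound b q z : 0 <= b -> 0 < q -> is_argmin X Psi z ->
  exists2 K, 0 <= K & forall y x u' g u, X y -> X x -> X u' ->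
  is_argmin X (prox_objective om chi gom f gf b q y x u' g) u ->
  nrm (u - z) ^+ 2 <= K * (1 + dual_norm nrm (g - h' u') ^+ 2
    + nrm (u' - z) ^+ 2 + nrm (y - z) ^+ 2 + nrm (x - z) ^+ 2).
Proof.
move=> b0 q0 zmin; set a := (mu + b + q).
have a0 : 0 < a by rewrite ltr_wpDl// addr_ge0// ltW.
have an : 0 < a * nu by rewrite mulr_gt0.
(* With this lam the loss L lam |u - z|^2 of the growth bound is at most half of the a nu / 2 |u -
   z|^2 that the Bregman term supplies. *)
pose lam := Num.min 1 (a * nu / (4 * L)).
have l01 : 0 < lam <= 1.
  by rewrite lt_min ltr01 divr_gt0 ?mulr_gt0//= ge_min lexx.
have [l0 _] := andP l01.
have lL : L * lam <= a * nu / 4.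
  have : lam <= a * nu / (4 * L) by rewrite ge_min lexx orbT.
  rewrite ler_pdivlMr ?mulr_gt0//; lra.
pose K1 := q / 2 + 1 + (M ^+ 2 + 1) / (nu * q) + L / lam + b / (2 * lam).
have k1 : 0 <= q / 2 by rewrite divr_ge0// ltW.
have k2 : 0 <= (nu * q)^-1 by rewrite invr_ge0 ltW// mulr_gt0.
have k3 : 0 <= L / lam by rewrite ltW// divr_gt0.
have k4 : 0 <= b / (2 * lam) by rewrite divr_ge0// ltW// mulr_gt0.
have k5 : 0 <= M ^+ 2 / (nu * q) by rewrite mulr_ge0// sqr_ge0.
have K10 : 0 <= K1 by rewrite /K1; lra.
exists (4 / (a * nu) * K1); first by rewrite mulr_ge0// divr_ge0// ltW.
move=> y x u' g u Xy Xx Xu' umin; have Xu := umin.1; have Xz := zmin.1.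
have h1 := inner_step b0 q0 Xu' Xz umin.
have h2 := inner_model_growth b0 l01 Xy Xx Xu zmin.
have h3 := ler_wpM2l (ltW q0) (Vle Xu' Xz).
have h4 := ler_wpM2l (ltW a0) (bregman_ge cX hn hom Xu Xz).
have h5 := dotv_le_dual hn (g - h' u') (z - u').
rewrite -/a in h1; rewrite (nrm_distC hn z) in h5; rewrite (nrm_distC hn z) in h4.
move: h1 h2 h3 h4 h5.
move: (dual_norm nrm _) => D.
have h6 : D * nrm (u' - z) <= D ^+ 2 + nrm (u' - z) ^+ 2.
  have := sqr_ge0 (D - nrm (u' - z)); have := sqr_ge0 (D + nrm (u' - z)).
  rewrite !expr2; lra.
have p1 := sqr_ge0 D; have p2 := sqr_ge0 (nrm (u' - z)).
have p3 := sqr_ge0 (nrm (y - z)); have p4 := sqr_ge0 (nrm (x - z)).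
move: (V u z) (V u' z) h6 p1 p2 p3 p4 => Vuz Vu'z.
have p5 := ler_wpM2r (sqr_ge0 (nrm (u - z))) lL.
move: (nrm (u - z) ^+ 2) p5 => U p5.
move: (nrm (u' - z) ^+ 2) (nrm (y - z) ^+ 2) (nrm (x - z) ^+ 2) (D ^+ 2).
move=> U' Y' X' D' h6 p1 p2 p3 p4 h1 h2 h3 h4 h5.
have : a * nu / 4 * U <= K1 * (1 + D' + U' + Y' + X').
  rewrite /K1.
  have := mulr_ge0 k2 p1; have := mulr_ge0 k2 p2; have := mulr_ge0 k2 p3; have := mulr_ge0 k2 p4.
  have := mulr_ge0 k3 p1; have := mulr_ge0 k3 p2; have := mulr_ge0 k3 p4.
  have := mulr_ge0 k4 p1; have := mulr_ge0 k4 p2; have := mulr_ge0 k4 p3.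
  have := mulr_ge0 k1 p1; have := mulr_ge0 k1 p3; have := mulr_ge0 k1 p4.
  have := mulr_ge0 k5 p1; have := mulr_ge0 k5 p2; have := mulr_ge0 k5 p3; have := mulr_ge0 k5 p4.
  lra.
have an4 : 0 < a * nu / 4 by rewrite divr_gt0.
move=> hU; rewrite -(ler_pM2l an4); apply: (le_trans hU); rewrite !mulrA divfK//.
by rewrite mulfV ?mul1r ?gt_eqF.
Qed.

(* W_t = (1 + rho)^-t and w = rho / (1 + rho) for all t, so that
   theta_t (1 - W_t) = w and (1 - W_t) ut_t is an exponential average of the u_s. *)
Lemma inner_loop b q rho y x z (T : nat) (u ut g : nat -> 'rV[R]_n) :
  0 <= b -> 0 < q -> 0 < rho -> rho * q = b + mu ->
  X z -> X (u 0%N) -> X (ut 0%N) ->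
  (forall t, (t < T)%N ->
    is_argmin X (prox_objective om chi gom f gf b q y x (u t) (g t.+1)) (u t.+1)) ->
  (forall t, (t < T)%N ->
    let theta := (1 - 1 / (1 + rho)) / (1 - 1 / (1 + rho) ^+ t.+1) in
    ut t.+1 = (1 - theta) *: ut t + theta *: u t.+1) ->
  let e t := dotv (g t - h' (u t.-1)) (z - u t.-1)
     + (M ^+ 2 + dual_norm nrm (g t - h' (u t.-1)) ^+ 2) / (nu * q) in
  forall t, (t <= T)%N ->
  [/\ X (u t), X (ut t) &
    (1 - (1 + rho) ^- t) * (inner_model b y x (ut t) - inner_model b y x z)
      + (b + mu) * V (u t) z
    <= (1 + rho) ^- t * (b + mu) * V (u 0%N) z + damped (rho / (1 + rho)) e t].
Proof.
move=> b0 q0 rho0 rhoq Xz Xu0 Xut0 umin hut e.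
have rho1 : 0 < 1 + rho by rewrite addr_gt0.
elim=> [_|t IH tT].
  by split=> //=; rewrite expr0 invr1 subrr mul0r add0r mul1r addr0.
have [Xu Xut {}IH] := IH (ltnW tT).
have ht := hut _ tT; have Xu1 := (umin _ tT).1.
have W0 : 0 < (1 + rho) ^- t by rewrite invr_gt0 exprn_gt0.
have W1 : (1 + rho) ^- t <= 1.
  by rewrite invf_le1 ?exprn_gt0// exprn_ege1// lerDl ltW.
have WS : (1 + rho) ^- t.+1 = (1 + rho) ^- t / (1 + rho).
  by rewrite exprSr invfM.
have step := inner_step (y := y) (x := x) b0 q0 Xu Xz (umin _ tT).
have {}step : inner_model b y x (u t.+1) + (mu + b + q) * V (u t.+1) z
    <= inner_model b y x z + q * V (u t) z + e t.+1.
  by rewrite /e /= addrA.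
rewrite /= WS; move: ht; rewrite /= !div1r WS.
set W := (1 + rho) ^- t in W0 W1 IH *.
have d0 : 0 < 1 - W / (1 + rho).
  by rewrite subr_gt0 ltr_pdivrMr// mul1r (le_lt_trans W1)// ltrDl.
set theta := (1 - (1 + rho)^-1) / (1 - W / (1 + rho)).
have thetaE : theta * (1 - W / (1 + rho)) = rho / (1 + rho).
  by rewrite divfK ?gt_eqF//; field; rewrite gt_eqF.
have theta0 : 0 <= theta.
  by rewrite divr_ge0 ?(ltW d0)// subr_ge0 invf_le1// lerDl ltW.
have theta1 : theta <= 1.
  by rewrite ler_pdivrMr// mul1r lerD2l lerN2 ler_pdivrMr// mulVf ?gt_eqF.
have th01 : 0 <= theta <= 1 by rewrite theta0.
move=> ->; split=> //; first exact: convex_setE.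
have conv := inner_model_convex y x b0 Xut Xu1 th01.
have {conv}conv := ler_wpM2l (ltW d0) conv.
have r0 : 0 <= rho / (1 + rho) by rewrite divr_ge0// ltW.
have r0' : 0 <= (1 + rho)^-1 by rewrite invr_ge0 ltW.
have step' := ler_wpM2l r0 step; have IH' := ler_wpM2l r0' IH.
have r1 : 1 - rho / (1 + rho) = (1 + rho)^-1 by field; rewrite gt_eqF.
(* The relation rho q = b + mu makes the Bregman terms telescope: after weighting, the old distance
   gets the factor (1 + rho)^-1 and the new one keeps b + mu. *)
have q1 : rho / (1 + rho) * q = (1 + rho)^-1 * (b + mu).
  by rewrite -rhoq mulrAC mulrC mulrA.
have q2 : rho / (1 + rho) * (mu + b + q) = b + mu.
  by rewrite mulrDr q1 (addrC mu) -mulrDl -[X in _ + X]mul1r; field; rewrite gt_eqF.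
rewrite r1.
have c1 : (1 - W / (1 + rho)) * (1 - theta) = (1 + rho)^-1 * (1 - W).
  by rewrite mulrBr mulr1 mulrC mulrC [_ * theta]mulrC thetaE; field; rewrite gt_eqF.
have c2 : (1 - W / (1 + rho)) * theta = rho / (1 + rho) by rewrite mulrC.
have {}conv : (1 - W / (1 + rho)) * inner_model b y x ((1 - theta) *: ut t + theta *: u t.+1)
    <= (1 + rho)^-1 * (1 - W) * inner_model b y x (ut t)
       + rho / (1 + rho) * inner_model b y x (u t.+1).
  by rewrite (le_trans conv)// mulrDr mulrA c1 mulrA c2.
have {}step' : rho / (1 + rho) * inner_model b y x (u t.+1) + (b + mu) * V (u t.+1) z
    <= rho / (1 + rho) * inner_model b y x z + (1 + rho)^-1 * (b + mu) * V (u t) z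
       + rho / (1 + rho) * e t.+1.
  by move: step'; rewrite !mulrDr !(mulrA (rho / (1 + rho))) -!mulrDr q1 q2.
have r2 : rho / (1 + rho) = 1 - (1 + rho)^-1 by field; rewrite gt_eqF.
move: conv step' IH'; rewrite r2 => {step}.
set m1 := inner_model _ _ _ (_ + _); set m2 := inner_model _ _ _ (ut t).
set m3 := inner_model _ _ _ (u t.+1); set m4 := inner_model _ _ _ z.
set v1 := V (u t.+1) z; set v2 := V (u t) z; set v3 := V (u 0%N) z.
set E := damped _ _ _; set et := e _.
lra.
Qed.

End composite.

(** * The parameters *)

Section parameters.
Context {R : realType}.
Implicit Types (v : R) (k t N : nat).

Lemma absz_ceil_bounds v : 0 <= v ->
  v <= (absz (Num.ceil v))%:R /\ (absz (Num.ceil v))%:R <= v + 1.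
Proof.
move=> v0; have := ceil_itv v.
have : (0 <= Num.ceil v)%R by rewrite ceil_ge0 (lt_le_trans _ v0)// ltrN10.
case: (Num.ceil v) => // m _ /andP[]; rewrite /= rmorphB/= -pmulrn.
by move=> /ltW h1 h2; split=> //; rewrite -lerBlDr.
Qed.

(** Replaces the real exponents k / 2 by natural powers of r = sqrt c. *)
Lemma powR_half (c : R) k : 0 <= c -> c `^ (k%:R / 2) = Num.sqrt c ^+ k.
Proof.
by move=> c0; rewrite mulrC powRrM powR12_sqrt// powR_mulrn// sqrtr_ge0.
Qed.

Lemma bernoulli2 (q : R) t : 0 <= q ->
  1 + t%:R * q + t%:R * (t%:R - 1) / 2 * q ^+ 2 <= (1 + q) ^+ t.
Proof.
move=> q0; elim: t => [|t IH]; first by rewrite !mul0r !addr0 expr0.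
rewrite [_ ^+ t.+1]exprSr; have q1 : 0 <= 1 + q by rewrite addr_ge0.
apply: (le_trans _ (ler_wpM2r q1 IH)).
rewrite -natr1 -subr_ge0.
have -> : (1 + t%:R * q + t%:R * (t%:R - 1) / 2 * q ^+ 2) * (1 + q) -
   (1 + (t%:R + 1) * q + (t%:R + 1) * (t%:R + 1 - 1) / 2 * q ^+ 2)
  = (t%:R * (t%:R - 1)) * (q ^+ 3 / 2) by field.
rewrite mulr_ge0 ?divr_ge0 ?exprn_ge0//.
by case: t {IH} => [|t]; rewrite ?mul0r// -natr1 addrK mulr_ge0.
Qed.

Variables (mu nu L : R).
Hypotheses (mu0 : 0 < mu) (nu0 : 0 < nu) (muL : nu * mu <= L).

Let s : R := Num.sqrt (L / (mu * nu)).
Let c : R := s / (1 + s).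
Let r : R := Num.sqrt c.
Let beta : R := L * (1 - c) / nu.

Let L0 : 0 < L := lt_le_trans (mulr_gt0 nu0 mu0) muL.
Let ratio0 : 0 < L / (mu * nu) := divr_gt0 L0 (mulr_gt0 mu0 nu0).

Lemma condition_ge1 : 1 <= s.
Proof.
rewrite -sqrtr1 ler_sqrt ?(ltW ratio0)//.
by rewrite ler_pdivlMr ?mulr_gt0// mul1r mulrC.
Qed.

Let s0 : 0 < s := lt_le_trans ltr01 condition_ge1.
Let s10 : 0 < 1 + s := addr_gt0 ltr01 s0.

Lemma condition_sqr : L = mu * nu * s ^+ 2.
Proof.
rewrite sqr_sqrtr.
  by rewrite mulrCA mulfV ?mulr1 ?mulf_neq0 ?gt_eqF.
exact: ltW.
Qed.

Lemma rate_gt0 : 0 < c. Proof. by rewrite divr_gt0. Qed.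

Lemma onem_rate : 1 - c = (1 + s)^-1.
Proof. by rewrite /c; field; rewrite gt_eqF. Qed.

Lemma rate_lt1 : c < 1.
Proof. by rewrite -subr_gt0 onem_rate invr_gt0. Qed.

Lemma rate_ge_half : 1 / 2 <= c.
Proof. rewrite ler_pdivlMr// mulrAC ler_pdivrMr//; have := condition_ge1; lra. Qed.

Lemma sqrt_rate_gt0 : 0 < r. Proof. by rewrite sqrtr_gt0 rate_gt0. Qed.

Lemma sqr_sqrt_rate : r ^+ 2 = c. Proof. by rewrite sqr_sqrtr// ltW ?rate_gt0. Qed.

Lemma sqrt_rate_lt1 : r < 1.
Proof.
rewrite -(@ltr_pXn2r _ 2)// ?nnegrE ?ler01 ?ltW ?sqrt_rate_gt0//.
by rewrite sqr_sqrt_rate expr1n rate_lt1.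
Qed.

Lemma rate_le_sqrt : c <= r.
Proof.
by rewrite -sqr_sqrt_rate expr2 ger_pMr ?sqrt_rate_gt0// ltW ?sqrt_rate_lt1.
Qed.

(** In terms of mu and s alone the parameters other than r are rational functions, which [field] can
    compare. *)
Lemma stepE : beta = mu * s ^+ 2 / (1 + s).
Proof.
rewrite /beta onem_rate condition_sqr; field.
by rewrite !gt_eqF.
Qed.

Lemma step_gt0 : 0 < beta.
Proof. by rewrite stepE divr_gt0// mulr_gt0// exprn_gt0. Qed.

Lemma stepDmu : beta + mu = mu * (s ^+ 2 + s + 1) / (1 + s).
Proof. by rewrite stepE; field; rewrite gt_eqF. Qed.

Lemma inner_lengthE :
  (beta + mu) * (1 - c) / (c * (beta + mu) - beta) = (s ^+ 2 + s + 1) / s.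
Proof.
have -> : c * (beta + mu) - beta = mu * s / (1 + s) ^+ 2.
  by rewrite stepDmu stepE /c; field; rewrite gt_eqF.
by rewrite stepDmu onem_rate; field; rewrite !gt_eqF.
Qed.

Let T k : nat := absz (Num.ceil (1 / c `^ (k%:R / 2)
             * ((beta + mu) * (1 - c) / (c * (beta + mu) - beta)))).

Lemma inner_length_bounds k : (s ^+ 2 + s + 1) / s / r ^+ k <= (T k)%:R /\
  (T k)%:R <= (s ^+ 2 + s + 1) / s / r ^+ k + 1.
Proof.
rewrite /T powR_half ?(ltW rate_gt0)// inner_lengthE mul1r [_^-1 * _]mulrC.
apply: absz_ceil_bounds; rewrite !divr_ge0 ?exprn_ge0 ?(ltW sqrt_rate_gt0) ?(ltW s0)//.
by rewrite !addr_ge0 ?exprn_ge0 ?(ltW s0).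
Qed.

Lemma inner_length_gt0 k : (0 < T k)%N.
Proof.
have [h _] := inner_length_bounds k; rewrite -(ltr_nat R).
apply: lt_le_trans h; rewrite !divr_gt0 ?exprn_gt0 ?sqrt_rate_gt0//.
by rewrite !addr_gt0 ?exprn_gt0.
Qed.

(* Condition (v) says nothing about k = 1; there the choice of T_1 suffices, by
   the second-order Bernoulli inequality and r >= 2 c / (1 + c). *)
Lemma first_weight_le :
  let W := (1 + r) ^- T 1 in
  W / (1 - W) * (beta + mu) + beta <= r * (beta + mu).
Proof.
have r0 := sqrt_rate_gt0; have r1 := sqrt_rate_lt1.
have q0 : 0 < s ^+ 2 + s + 1 by rewrite !addr_gt0 ?exprn_gt0.
pose y := (s ^+ 2 + s + 1) / s.
have y0 : 0 < y by rewrite divr_gt0.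
have yT : y <= (T 1)%:R * r.
  by rewrite -ler_pdivrMr//; case: (inner_length_bounds 1).
have y1 : 1 <= y by rewrite ler_pdivlMr// mul1r; have := exprn_gt0 2 s0; lra.
(* As T_1 r >= y and r < 1, the second-order bound is at least 1 + y + y (y - 1) / 2. The linear
   term alone would require r >= (s^2 + s) / (s^2 + s + 1), false for large s, where r is about 1 -
   1 / (2 s). *)
have hB : y * (y + 1) / 2 <= (1 + r) ^+ T 1 - 1.
  rewrite lerBrDl; apply: le_trans (bernoulli2 (T 1) (ltW r0)).
  have : y * (y - 1) <= (T 1)%:R * r * ((T 1)%:R * r - r).
    by apply: ler_pM => //; [exact: ltW|lra|lra].
  rewrite !expr2; lra.
have p0 : 0 < y * (y + 1) / 2 by rewrite divr_gt0// mulr_gt0// addr_gt0.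
have B0 := lt_le_trans p0 hB.
rewrite /=; move: ((1 + r) ^+ T 1) hB B0 => B hB B0.
have B1 : 0 < B by lra.
have -> : B^-1 / (1 - B^-1) = (B - 1)^-1.
  by field; rewrite !gt_eqF.
(* With c = r^2 this is 2 r <= 1 + r^2. It replaces the irrational r by a rational function of s. *)
have rX : 2 * s / (1 + 2 * s) <= r.
  have -> : 2 * s / (1 + 2 * s) = 2 * c / (1 + c).
    by rewrite /c; field; rewrite !gt_eqF ?addr_gt0.
  rewrite ler_pdivrMr ?addr_gt0 ?rate_gt0// -sqr_sqrt_rate.
  have : 0 <= r * (r - 1) ^+ 2 by rewrite mulr_ge0 ?sqr_ge0// ltW.
  rewrite !expr2; lra.
have hb : (B - 1)^-1 <= (y * (y + 1) / 2)^-1.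
  by rewrite lef_pV2 ?posrE.
have bm0 : 0 < beta + mu by rewrite addr_gt0 ?step_gt0.
rewrite -(lerBrDr _ _ beta) -ler_pdivlMr//.
have -> : (r * (beta + mu) - beta) / (beta + mu) = r - s ^+ 2 / (s ^+ 2 + s + 1).
  rewrite mulrBl mulfK ?gt_eqF//; congr (_ - _).
  by rewrite stepDmu stepE; field; rewrite !gt_eqF.
apply: (le_trans hb); rewrite lerBrDr; apply: le_trans rX.
have -> : (y * (y + 1) / 2)^-1 = 2 * s ^+ 2 / ((s ^+ 2 + s + 1) * (s + 1) ^+ 2).
  rewrite /y; field; rewrite !gt_eqF// addrC//.
  by rewrite addr_gt0// addrC.
rewrite -subr_ge0.
(* The difference is a quotient of polynomials in s with nonnegative coefficients. *)
have -> : 2 * s / (1 + 2 * s)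
    - (2 * s ^+ 2 / ((s ^+ 2 + s + 1) * (s + 1) ^+ 2) + s ^+ 2 / (s ^+ 2 + s + 1))
  = s * (s ^+ 3 + 3 * s + 2) / ((1 + 2 * s) * ((s ^+ 2 + s + 1) * (s + 1) ^+ 2)).
  by field; rewrite !gt_eqF// ?addr_gt0// ?mulr_gt0//.
by rewrite divr_ge0 ?mulr_ge0 ?addr_ge0 ?exprn_ge0 ?mulr_ge0 1?ltW.
Qed.

(** From ln c <= c - 1 = - 1 / (1 + s) and s >= 1. This converts N into order s ln m. *)
Lemma ln_rate_ge : (2 * s)^-1 <= ln (1 / c).
Proof.
rewrite mul1r lnV ?posrE ?rate_gt0//.
have : ln c <= - (1 - c).
  rewrite -{1}(subrK 1 c) addrC -[c - 1]opprB.
  by apply: le_ln1Dx; have := rate_gt0; lra.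
rewrite onem_rate lerNr => h; apply: le_trans h.
by rewrite lef_pV2 ?posrE ?mulr_gt0//; have := condition_ge1; lra.
Qed.

Lemma ln_rate_gt0 : 0 < ln (1 / c).
Proof. by apply: lt_le_trans ln_rate_ge; rewrite invr_gt0 mulr_gt0. Qed.

(** * Number of epochs and evaluation counts *)

Section horizon.
Variables (A eps : R).
Hypotheses (A0 : 0 < A) (eps0 : 0 < eps).

Let m : R := Num.max (A / eps) 1.
Let N : nat := maxn 1 (absz (Num.ceil (2 * ln m / ln (1 / c)))).

Let m1 : 1 <= m. Proof. by rewrite le_max lexx orbT. Qed.
Let m0 : 0 < m := lt_le_trans ltr01 m1.

Lemma horizon_gt0 : (0 < N)%N. Proof. by rewrite leq_max. Qed.

Lemma horizon_bounds : 2 * ln m <= N%:R * ln (1 / c) /\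
  N%:R * ln (1 / c) <= 2 * ln m + ln (1 / c).
Proof.
have l0 := ln_rate_gt0.
have v0 : 0 <= 2 * ln m / ln (1 / c).
  by apply: divr_ge0 (ltW l0); rewrite mulr_ge0 ?ln_ge0.
have [h1 h2] := absz_ceil_bounds v0.
have hN : 2 * ln m / ln (1 / c) <= N%:R /\ N%:R <= 2 * ln m / ln (1 / c) + 1.
  rewrite /N; split; first by rewrite (le_trans h1)// ler_nat leq_maxr.
  by case: leqP => // _; rewrite lerDr.
move: hN => [+]; rewrite ler_pdivrMr// => hN.
by rewrite -lerBlDr ler_pdivlMr// mulrBl lerBlDr [X in _ + X]mul1r.
Qed.

Lemma ln_sqrt_rate : ln (1 / c) = - (2 * ln r).
Proof.
rewrite mul1r lnV ?posrE ?rate_gt0// -sqr_sqrt_rate lnXn ?sqrt_rate_gt0//.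
by rewrite mulr_natl.
Qed.

Let ln_rNm : ln (r ^+ N * m) = N%:R * ln r + ln m.
Proof.
by rewrite lnM ?posrE ?exprn_gt0 ?sqrt_rate_gt0// lnXn ?sqrt_rate_gt0// mulr_natl.
Qed.

Lemma horizon_contraction : r ^+ N * m <= 1.
Proof.
rewrite -ler_ln ?posrE ?mulr_gt0 ?exprn_gt0 ?sqrt_rate_gt0// ln1 ln_rNm.
by have [+ _] := horizon_bounds; rewrite ln_sqrt_rate; lra.
Qed.

Lemma horizon_accuracy : r ^+ N * A <= eps.
Proof.
have : A / eps <= m by rewrite le_max lexx.
rewrite ler_pdivrMr// => /(ler_wpM2l (ltW (exprn_gt0 N sqrt_rate_gt0))).
move=> /le_trans; apply; rewrite mulrA ger_pMl//; exact: horizon_contraction.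
Qed.

(** The ceiling overshoots by at most one epoch, hence r <= r^N m, and r >= c >= 1 / 2. Needed
    because the inner lengths grow like r^-k. *)
Lemma horizon_expansion : r ^- N <= 2 * m.
Proof.
have r0 := sqrt_rate_gt0.
have r2 : 1 <= 2 * r by have := rate_ge_half; have := rate_le_sqrt; lra.
have h : r <= r ^+ N * m.
  rewrite -ler_ln ?posrE ?mulr_gt0 ?exprn_gt0// ln_rNm.
  by have [_] := horizon_bounds; rewrite ln_sqrt_rate; lra.
have rN : 0 < r ^+ N by rewrite exprn_gt0.
rewrite -(ler_pM2l rN) mulfV ?gt_eqF// mulrCA; apply: (le_trans r2).
by rewrite ler_wpM2l.
Qed.

Lemma gradient_evaluationsE K : gradient_evaluations K = K.
Proof. by rewrite /gradient_evaluations sum_nat_const_nat subSS subn0 muln1. Qed.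

Lemma horizon_le : N%:R <= 1 + 4 * s * ln m.
Proof.
have l0 := ln_rate_gt0; have [_ h] := horizon_bounds.
have : N%:R <= 2 * ln m * (ln (1 / c))^-1 + 1.
  by rewrite -lerBlDr ler_pdivlMr// mulrBl lerBlDr [X in _ + X]mul1r.
move=> /le_trans; apply; rewrite addrC lerD2l.
have : (ln (1 / c))^-1 <= 2 * s.
  by rewrite -[leRHS]invrK lef_pV2 ?posrE ?invr_gt0 ?mulr_gt0 ?ln_rate_ge.
move=> /(ler_wpM2l (mulr_ge0 (ler0n R 2) (ln_ge0 m1))); lra.
Qed.

(** The lengths are dominated by a geometric series, bounded by its last term r^-N over 1 - r. The
    factors are (s^2 + s + 1) / s <= 3 s, (1 - r)^-1 = (1 + r) (1 + s) <= 4 s and r^-N <= 2 m, of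
    product 24 s^2 m; rounding up costs one call per epoch. *)
Lemma oracle_evaluations_le :
  (oracle_evaluations N T)%:R <= N%:R + 24 * (s ^+ 2 * m).
Proof.
have r0 := sqrt_rate_gt0; have r1 := sqrt_rate_lt1.
have r1' : 0 < 1 - r by rewrite subr_gt0.
have q3 : (s ^+ 2 + s + 1) / s <= 3 * s.
  by rewrite ler_pdivrMr//; have := condition_ge1; nra.
have sumT K : (oracle_evaluations K T)%:R <= K%:R + 3 * s * (r ^- K / (1 - r)).
  elim: K => [|K IH].
    rewrite /oracle_evaluations big_geq// add0r expr0 invr1.
    by rewrite !mulr_ge0 ?invr_ge0 ?ler01// ltW.
  rewrite /oracle_evaluations big_nat_recr//= -/(oracle_evaluations K T).
  rewrite sum_nat_const_nat subSS subn0 muln1 natrD -natr1.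
  have [_ hT] := inner_length_bounds K.+1.
  have rK : 0 < r ^- K.+1 by rewrite invr_gt0 exprn_gt0.
  have h1 := ler_wpM2r (ltW rK) q3.
  have -> : r ^- K.+1 / (1 - r) = r ^- K / (1 - r) + r ^- K.+1.
    by rewrite exprS; field; rewrite !gt_eqF ?exprn_gt0.
  rewrite mulrDr; lra.
apply: (le_trans (sumT N)); rewrite lerD2l.
have h : (1 - r)^-1 <= 4 * s.
  have -> : (1 - r)^-1 = (1 + r) * (1 + s).
    have e : (1 - r) * ((1 + r) * (1 + s)) = 1.
      rewrite mulrA -subr_sqr expr1n sqr_sqrt_rate onem_rate mulVf ?gt_eqF//.
    by apply: (@mulfI _ (1 - r)); rewrite ?gt_eqF// e mulfV ?gt_eqF.
  have := condition_ge1; nra.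
have h2 : r ^- N / (1 - r) <= 2 * m * (4 * s).
  apply: ler_pM => //; first by rewrite invr_ge0 exprn_ge0// ltW.
    by rewrite invr_ge0 ltW.
  exact: horizon_expansion.
rewrite (_ : 24 * (s ^+ 2 * m) = 3 * s * (2 * m * (4 * s))); last by ring.
by rewrite ler_wpM2l// mulr_ge0// ltW.
Qed.

Let sln0 : 0 <= s * ln m. Proof. by rewrite mulr_ge0 ?ln_ge0// ltW. Qed.

Lemma gradient_complexity : N%:R <= 25 * (1 + s * ln m).
Proof. by apply: (le_trans horizon_le); have := sln0; lra. Qed.

(** For eps <= A the first term is s^2 m >= 1 and absorbs the 1 in the bound on N, so 25 = 24 + 1.
    For large eps that term tends to 0 while at least one call is made. *)
Lemma oracle_complexity : eps <= A ->
  (oracle_evaluations N T)%:R <= 25 * (A * L / (mu * nu * eps) + s * ln m).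
Proof.
move=> epsA; have mE : m = A / eps.
  by rewrite /m; apply/max_idPl; rewrite ler_pdivlMr// mul1r.
have -> : A * L / (mu * nu * eps) = s ^+ 2 * m.
  by rewrite mE condition_sqr; field; rewrite !gt_eqF.
apply: (le_trans oracle_evaluations_le).
have : 1 <= s ^+ 2 * m by rewrite mulr_ege1 ?m1// exprn_ege1 ?condition_ge1.
have := sln0; have := horizon_le; move: (N%:R) => N'; lra.
Qed.

End horizon.

Lemma outer_telescoping N (S v e a b noise : nat -> R) :
  (0 < N)%N ->
  (forall k, (k <= N)%N -> 0 <= v k) -> (forall k, (0 < k)%N -> 0 <= b k) -> 0 <= S 0%N ->
  noise 0%N = 0 ->
  (forall k, (k < N)%N -> noise k.+1 = c * noise k + (1 - c) * e k.+1) ->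
  (forall k, (k < N)%N -> S k.+1 <= c * S k + (1 - c) *
     ((a k.+1 * (beta + mu) + beta) * v k - (beta + mu) * b k.+1 * v k.+1 + e k.+1)) ->
  (forall k, (0 < k)%N -> a k.+1 * (beta + mu) + beta <= c * ((beta + mu) * b k)) ->
  a 1%N * (beta + mu) + beta <= r * (beta + mu) ->
  S N <= r ^+ N * (S 0%N + (beta + mu) * (1 - c) * v 0%N) + noise N.
Proof.
move=> N0 v0 b0 S0 n0 hn hS hv ha.
have c0 := rate_gt0; have r0 := sqrt_rate_gt0; have r1 := sqrt_rate_lt1.
have c1 : 0 <= 1 - c by rewrite subr_ge0 ltW ?rate_lt1.
have bm0 : 0 < beta + mu by rewrite addr_gt0 ?step_gt0.
have H k : (k < N)%N -> S k.+1 + (1 - c) * ((beta + mu) * b k.+1) * v k.+1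
    <= c ^+ k * (c * S 0%N + (1 - c) * (r * (beta + mu)) * v 0%N) + noise k.+1.
  elim: k => [|k IH] kN.
    have := hS _ kN; rewrite hn// n0 expr0.
    have := ler_wpM2l c1 (ler_wpM2r (v0 0%N isT) ha); lra.
  have := hS _ kN; rewrite (hn _ kN).
  have := ler_wpM2l c1 (ler_wpM2r (v0 k.+1 (ltnW kN)) (hv k.+1 isT)).
  have := ler_wpM2l (ltW c0) (IH (ltnW kN)); rewrite exprS.
  move: (c ^+ k) => ck; lra.
case: N N0 v0 H {hn hS} => // N _ v0 /(_ N (ltnSn N)) H.
have : 0 <= (1 - c) * ((beta + mu) * b N.+1) * v N.+1.
  by rewrite !mulr_ge0 ?v0 ?b0// ltW.
have h : c ^+ N * (c * S 0%N + (1 - c) * (r * (beta + mu)) * v 0%N) <=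
   r ^+ N.+1 * (S 0%N + (beta + mu) * (1 - c) * v 0%N).
  have cr : c ^+ N <= r ^+ N by apply: lerXn2r; rewrite ?nnegrE ?(ltW c0) ?(ltW r0) ?rate_le_sqrt.
  have -> : r ^+ N.+1 * (S 0%N + (beta + mu) * (1 - c) * v 0%N) =
     r ^+ N * (r * S 0%N + (1 - c) * (r * (beta + mu)) * v 0%N).
    by rewrite exprSr; ring.
  have hX : c * S 0%N + (1 - c) * (r * (beta + mu)) * v 0%N <=
    r * S 0%N + (1 - c) * (r * (beta + mu)) * v 0%N.
    by rewrite lerD2r ler_wpM2r ?rate_le_sqrt.
  have p2 : 0 <= c * S 0%N by rewrite mulr_ge0// ltW.
  have p3 : 0 <= (1 - c) * (r * (beta + mu)) * v 0%N.
    by rewrite !mulr_ge0 ?v0 ?(ltW r0) ?(ltW bm0).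
  by apply: ler_pM hX => //; [rewrite exprn_ge0 ?(ltW c0)|rewrite addr_ge0].
lra.
Qed.

(** Since 1 - c = (1 - r) (1 + r), the sequence (1 + r) r^k solves exactly the outer recursion with
    input r^k. *)
Lemma noise_recursion k : c * ((1 + r) * r ^+ k) + (1 - c) * r ^+ k.+1
  = (1 + r) * r ^+ k.+1.
Proof. by rewrite -sqr_sqrt_rate !exprS expr0 ; ring. Qed.

End parameters.

(** * Measurability and conditional expectation *)

Section borel.
Context {R : realType} {d : measure_display} {Om : measurableType d}.
Implicit Types (G : set (set Om)).

Lemma measurable_wrt_open (E : topologicalType) G (Y : Om -> E) :
  (forall O, open O -> <<s G>> (Y @^-1` O)) -> measurable_wrt <<s G>> Y.
Proof.
move=> hO; apply: (@smallest_sub _ _ _ [set B | <<s G>> (Y @^-1` B)]) => //.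
split=> [|A hA|A hA] /=.
- by rewrite preimage_set0; exact: sigma_algebra0.
- by rewrite setTD preimage_setC -setTD; exact: sigma_algebraCD.
- by rewrite preimage_bigcup; exact: sigma_algebra_bigcup.
Qed.

Lemma borel_open (E : topologicalType) (O : set E) : open O -> borel O.
Proof. exact: sub_sigma_algebra. Qed.

Lemma borel_realE (B : set R) : borel B <-> measurable B.
Proof.
split=> [|mB].
  apply: smallest_sub; last exact: open_measurable.
  split=> [|A mA|A mA]; first exact: measurable0.
  - by rewrite setTD; exact: measurableC.
  - exact: bigcupT_measurable.
have : (@RGenOpens.G R).-sigma.-measurable B by rewrite -RGenOpens.measurableE.
apply: smallest_sub; first exact: smallest_sigma_algebra.
by move=> _ [x [y ->]]; apply: borel_open; exact: interval_open.
Qed.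

Lemma measurable_wrtP G (Y : Om -> R) : measurable_wrt <<s G>> Y <->
  measurable_fun [set: g_sigma_algebraType G] (Y : g_sigma_algebraType G -> R).
Proof.
split=> [mY _ B mB|mY B /borel_realE mB].
  by rewrite setTI; apply: mY; exact/borel_realE.
by rewrite -[_ @^-1` _]setTI; exact: mY.
Qed.

Lemma measurable_fun_gen G (Y : Om -> R) : G `<=` measurable ->
  measurable_fun [set: g_sigma_algebraType G] (Y : g_sigma_algebraType G -> R) ->
  measurable_fun [set: Om] Y.
Proof.
move=> Gm mY _ B mB; have := mY measurableT B mB.
apply: smallest_sub => //; split=> [|A mA|A mA]; first exact: measurable0.
- by rewrite setTD; exact: measurableC.
- exact: bigcupT_measurable.
Qed.

Lemma measurable_wrtS (E : topologicalType) G1 G2 (Y : Om -> E) :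
  <<s G1>> `<=` <<s G2>> -> measurable_wrt <<s G1>> Y -> measurable_wrt <<s G2>> Y.
Proof. by move=> G12 mY B /mY /G12. Qed.

(* Y is a continuous function of Z only on the range of Z, which need not be a
   measurable set: this covers maps defined on X and argmins that need not exist
   elsewhere. *)
Lemma measurable_wrt_factor (E E' : normedModType R) G (Z : Om -> E) (Y : Om -> E') :
  (forall w e, 0 < e -> exists2 r, 0 < r &
    forall w', `|Z w - Z w'| < r -> `|Y w - Y w'| < e) ->
  measurable_wrt <<s G>> Z -> measurable_wrt <<s G>> Y.
Proof.
move=> ZY mZ; apply: measurable_wrt_open => O oO.
pose I := [set p : Om * R | 0 < p.2 /\
  forall w, ball (Z p.1) p.2 (Z w) -> O (Y w)].
have -> : Y @^-1` O = Z @^-1` (\bigcup_(p in I) ball (Z p.1) p.2).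
  apply/seteqP; split=> w /=; last by move=> [p [p0 pO] /pO].
  move=> OYw; have /nbhs_ballP[e /= e0 eO] := open_nbhs_nbhs (conj oO OYw).
  have [r r0 hr] := ZY w e e0.
  exists (w, r); last exact: ballxx.
  split=> //= w'; rewrite -ball_normE /= => /hr h.
  by apply: eO; rewrite -ball_normE.
apply: mZ; apply: borel_open; apply: bigcup_open => p [p0 _].
exact: ball_open.
Qed.

Lemma measurable_wrt_continuous_within n m (X : set 'rV[R]_n)
    (g : 'rV[R]_n -> 'rV[R]_m) G (v : Om -> 'rV[R]_n) :
  {within X, continuous g} -> (forall w, X (v w)) ->
  measurable_wrt <<s G>> v -> measurable_wrt <<s G>> (fun w => g (v w)).
Proof.
move=> cg Xv; apply: measurable_wrt_factor => w e e0.
move/subspace_continuousP : cg => /(_ _ (Xv w)).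
move=> /cvgrPdist_lt /(_ e e0) /nbhs_ballP[r /= r0 hr].
exists r => // w' h; apply: hr => //.
by rewrite -ball_normE.
Qed.

Lemma measurable_wrt_coord n G (v : Om -> 'rV[R]_n) i :
  measurable_wrt <<s G>> v -> measurable_wrt <<s G>> (fun w => v w 0 i).
Proof.
apply: (@measurable_wrt_factor _ R^o) => w e e0; exists e => // w'.
by apply: le_lt_trans; have := coord_le_norm (v w - v w') i; rewrite !mxE.
Qed.

Let box n (p : 'rV[rat]_n * rat) : set 'rV[R]_n :=
  [set z | forall i, `|z 0 i - ratr (p.1 0 i)| <= ratr p.2].

Let open_bigcup_box n (O : set 'rV[R]_n) : open O ->
  O = \bigcup_(p in [set p | box p `<=` O]) box p.
Proof.
move=> oO; apply/seteqP; split=> [x Ox|x [p pO /pO]//].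
have /nbhs_ballP[e /= e0 eO] := open_nbhs_nbhs (conj oO Ox).
have e2 : 0 < e / 2 by rewrite divr_gt0.
have [r] := rat_in_itvoo e2; rewrite in_itv/= => /andP[r0 re].
have /choice[q hq] : forall i, exists q : rat, `|x 0 i - ratr q| <= ratr r.
  move=> i; have [|q] := @rat_in_itvoo _ (x 0 i - ratr r) (x 0 i + ratr r).
    lra.
  rewrite in_itv/= => /andP[h1 h2]; exists q.
  by rewrite ler_norml; apply/andP; split; lra.
exists (\row_i q i, r) => [z /= hz|i /=]; last by rewrite mxE.
apply: eO; rewrite -ball_normE /=.
apply: (@le_lt_trans _ _ (ratr r + ratr r)); last lra.
apply: norm_le_coord => [|i]; first by rewrite addr_ge0// ltW.
rewrite !mxE -(subrK (ratr (q i)) (x 0 i)) -addrA (le_trans (ler_normD _ _))//.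
by rewrite lerD// distrC; have := hz i; rewrite mxE.
Qed.

(** Borel sets are generated by open sets, so a countable base is needed: an open set is a union of
    rational boxes, and a box is a finite intersection of coordinate conditions. *)
Lemma measurable_wrt_row n G (v : Om -> 'rV[R]_n) :
  (forall i, measurable_wrt <<s G>> (fun w => v w 0 i)) -> measurable_wrt <<s G>> v.
Proof.
move=> mv; apply: measurable_wrt_open => O /open_bigcup_box ->.
rewrite preimage_bigcup.
pose F k := if unpickle k is Some p then
  if `[< box p `<=` O >] then v @^-1` box p else set0 else set0.
have -> : \bigcup_(p in [set p | box p `<=` O]) v @^-1` box p = \bigcup_k F k.
  apply/seteqP; split=> [w [p pO vw]|w [k _]].
    by exists (pickle p) => //; rewrite /F pickleK; case: asboolP.
  by rewrite /F; case: unpickle => // p; case: asboolP => // pO vw; exists p.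
apply: sigma_algebra_bigcup => k; rewrite /F.
case: unpickle => [p|]; last exact: sigma_algebra0.
case: asboolP => _; last exact: sigma_algebra0.
have -> : v @^-1` box p = \bigcap_(i in [set: 'I_n])
    ((fun w => v w 0 i) @^-1` `[ratr (p.1 0 i) - ratr p.2, ratr (p.1 0 i) + ratr p.2]).
  apply/seteqP; split=> w /= h i; first by move=> _; rewrite /= in_itv/= -ler_distl.
  by have := h i I; rewrite /= in_itv/= -ler_distl.
apply: (@fin_bigcap_measurable _ (g_sigma_algebraType G)) => // i _.
have /measurable_wrtP := mv i => mvi; rewrite -[_ @^-1` _]setTI.
exact: mvi.
Qed.

End borel.

(** * Conditional expectations on a generated sigma-field *)

Section conditional_expectation.
Import HBNNSimple.
Context {R : realType} {d : measure_display} {Om : measurableType d}.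
Variables (P : probability Om R) (G : set (set Om)).
Hypothesis Gm : G `<=` measurable.

Lemma gen_measurable A : <<s G>> A -> measurable A.
Proof.
apply: smallest_sub => //; split=> [|B mB|B mB]; first exact: measurable0.
- by rewrite setTD; exact: measurableC.
- exact: bigcupT_measurable.
Qed.

Lemma disjoint_cover (Y : Om -> R) (D : nat -> set Om) :
  (forall i, <<s G>> (D i)) -> \bigcup_i D i = setT ->
  (forall i, P.-integrable (D i) (EFin \o Y)) ->
  exists D' : nat -> set Om, [/\ trivIset setT D', forall i, <<s G>> (D' i),
    \bigcup_i D' i = setT & forall i, P.-integrable (D' i) (EFin \o Y)].
Proof.
move=> FD UD iD; exists (seqDU D).
have FD' i : <<s G>> (seqDU D i).
  apply: (@measurableD _ (g_sigma_algebraType G)); first exact: FD.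
  by apply: bigsetU_measurable => j _; exact: FD.
split=> //; first by rewrite -seqDU_bigcup_eq.
move=> i; apply: integrableS (iD i); [exact: gen_measurable|exact: gen_measurable|].
exact: subset_seqDU.
Qed.

(** The definition equates integrals only where Y is integrable, so A is cut along the cover;
    integrability of Y - Z on the whole space then sums the pieces. *)
Lemma cond_exp_centered (Y Z : Om -> R) A : is_cond_exp P <<s G>> Y Z ->
  P.-integrable setT (EFin \o (Y \- Z)) -> <<s G>> A ->
  (\int[P]_(w in A) (EFin \o (Y \- Z)%R) w = 0)%E.
Proof.
move=> [_ [D [FD UD iD]] condZ] iYZ FA.
have {FD UD iD}[D' [tD FD UD iD]] := disjoint_cover FD UD iD.
have FAD i : <<s G>> (A `&` D' i).
  apply: (@measurableI _ (g_sigma_algebraType G)); [exact: FA|exact: FD].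
have UAD : A = \bigcup_i (A `&` D' i) by rewrite -setI_bigcupr UD setIT.
rewrite UAD integral_bigcup.
- apply: eseries0 => i _ _.
  have iY : P.-integrable (A `&` D' i) (EFin \o Y).
    by apply: integrableS (iD i) => //; exact: gen_measurable.
  have [iZ eZ] := condZ _ (FAD i) iY.
  rewrite integralB_EFin//; last exact: gen_measurable.
  by rewrite eZ subee// integrable_fin_num//; exact: gen_measurable.
- exact: trivIset_setIl.
- by move=> i; exact: gen_measurable.
- rewrite -UAD; apply: integrableS iYZ => //; exact: gen_measurable.
Qed.

Lemma centered_orthogonal_nnsfun (g : Om -> R)
    (phi : {nnsfun (g_sigma_algebraType G) >-> R}) :
  P.-integrable setT (EFin \o g) ->
  (forall A, <<s G>> A -> \int[P]_(w in A) (EFin \o g) w = 0)%E ->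
  (\int[P]_w (g w * phi w)%:E = 0)%E.
Proof.
move=> ig g0.
pose s := fset_set (phi @` setT).
under eq_integral => w _.
  rewrite (fimfunEord phi w) mulr_sumr -sumEFin.
  under eq_bigr => i _ do rewrite mulrCA EFinM.
  over.
have FA y : <<s G>> (phi @^-1` [set y]).
  by have := measurable_funP phi measurableT _ (measurable_set1 y); rewrite setTI.
have mA y : measurable (phi @^-1` [set y] : set Om) by exact: gen_measurable.
have eA y : (fun w => (g w * \1_(phi @^-1` [set y]) w)%:E) =
    (EFin \o g) \_ (phi @^-1` [set y]).
  by rewrite epatch_indic; apply/funext => w /=; rewrite EFinM.
have iA y : P.-integrable setT (fun w => (g w * \1_(phi @^-1` [set y]) w)%:E).
  by rewrite eA -integrable_mkcond//; exact: integrableS ig.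
rewrite integral_sum//; last by move=> i; exact: integrableZl.
rewrite big1// => i _; rewrite integralZl// eA -integral_mkcond g0 ?mule0//.
Qed.

Lemma centered_orthogonal_ge0 (g zeta : Om -> R) :
  P.-integrable setT (EFin \o g) ->
  (forall A, <<s G>> A -> \int[P]_(w in A) (EFin \o g) w = 0)%E ->
  measurable_wrt <<s G>> zeta -> (forall w, 0 <= zeta w) ->
  P.-integrable setT (fun w => (g w * zeta w)%:E) ->
  (\int[P]_w (g w * zeta w)%:E = 0)%E.
Proof.
move=> ig g0 /measurable_wrtP mz z0 igz.
have mzE : measurable_fun [set: g_sigma_algebraType G] (EFin \o zeta).
  exact/measurable_EFinP.
pose phi := nnsfun_approx measurableT mzE.
have z0E (w : g_sigma_algebraType G) : setT w -> (0 <= (EFin \o zeta) w)%E.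
  by rewrite lee_fin z0.
have cphi w : (fun n => (phi n w)%:E) @ \oo --> (zeta w)%:E.
  exact: (cvg_nnsfun_approx measurableT mzE z0E).
have cphiR w : (fun n => phi n w) @ \oo --> zeta w by have /fine_cvgP[] := cphi w.
have le_phi n w : phi n w <= zeta w.
  have nd : nondecreasing_seq (fun n => phi n w).
    by move=> i j ij; have /lefP := nd_nnsfun_approx measurableT mzE ij; exact.
  rewrite -(cvg_lim _ (cphiR w))//.
  by apply: nondecreasing_cvgn_le => //; apply/cvg_ex; exists (zeta w).
have mg := measurable_int _ ig.
have mphi n : measurable_fun [set: Om] (fun w => (g w * phi n w)%:E).
  apply/measurable_EFinP/measurable_funM; first exact/measurable_EFinP.
  by apply: (measurable_fun_gen Gm); exact: measurable_funP.
have [|||_ _] := @dominated_convergence _ _ _ P setT measurableT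
  (fun n w => (g w * phi n w)%:E) (fun w => (g w * zeta w)%:E)
  (fun w => `|(g w * zeta w)%:E|)%E mphi (measurable_int _ igz).
- apply: aeW => w _; apply: cvg_EFin; first exact: nearW.
  rewrite /comp/=; apply: cvgMr; exact: cphiR.
- exact: integrable_abse.
- apply: aeW => w n _; rewrite lee_fin !normrM ler_wpM2l//.
  by rewrite !ger0_norm.
move=> /cvg_lim <-//.
under eq_fun do rewrite centered_orthogonal_nnsfun//.
exact: lim_cst.
Qed.

End conditional_expectation.

Section conditional_moments.
Context {R : realType} {d : measure_display} {Om : measurableType d}.
Variables (P : probability Om R) (G : set (set Om)).
Hypothesis Gm : G `<=` measurable.

Lemma centered_orthogonal (g zeta : Om -> R) :
  P.-integrable setT (EFin \o g) ->
  (forall A, <<s G>> A -> \int[P]_(w in A) (EFin \o g) w = 0)%E ->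
  measurable_wrt <<s G>> zeta ->
  P.-integrable setT (fun w => (g w * zeta w)%:E) ->
  (\int[P]_w (g w * zeta w)%:E = 0)%E.
Proof.
move=> ig g0 mz igz; have /measurable_wrtP mzG := mz.
have mzO := measurable_fun_gen Gm mzG.
have mg : measurable_fun setT g by apply/measurable_EFinP; exact: measurable_int ig.
have ipart (y : Om -> R) : measurable_fun setT y ->
    (forall w, `|y w| <= `|zeta w|) -> P.-integrable setT (fun w => (g w * y w)%:E).
  move=> my hy; apply: le_integrable igz => //.
    exact/measurable_EFinP/measurable_funM.
  by move=> w _; rewrite lee_fin !normrM ler_wpM2l.
have ip : P.-integrable setT (fun w => (g w * zeta^\+ w)%:E).
  apply: ipart => [|w]; first exact: measurable_funrpos.
  by rewrite ger0_norm// /funrpos ge_max ler_norm normr_ge0.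
have im : P.-integrable setT (fun w => (g w * zeta^\- w)%:E).
  apply: ipart => [|w]; first exact: measurable_funrneg.
  by rewrite ger0_norm// /funrneg ge_max normr_ge0 andbT -normrN ler_norm.
transitivity (\int[P]_w ((g w * zeta^\+ w)%:E - (g w * zeta^\- w)%:E))%E.
  apply: eq_integral => w _; rewrite -EFinB -mulrBr.
  by rewrite -[zeta in LHS]funrposBneg.
rewrite integralB// !(centered_orthogonal_ge0 Gm) ?sube0//.
- exact/measurable_wrtP/measurable_funrneg.
- exact/measurable_wrtP/measurable_funrpos.
Qed.

Lemma cond_exp_measurable (Y Z : Om -> R) :
  is_cond_exp P <<s G>> Y Z -> measurable_fun setT Y.
Proof.
move=> [_ [D [FD UD iD]] _]; rewrite -UD.
apply/measurable_fun_bigcup => i; first by apply: (gen_measurable Gm); exact: FD.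
by apply/measurable_EFinP; exact: measurable_int (iD i).
Qed.

(** The source of global integrability: on each disjoint piece Y has the integral of Z, at most s
    times the mass of the piece, and the masses add up to 1. *)
Lemma cond_exp_le (Y Z : Om -> R) (s : R) : is_cond_exp P <<s G>> Y Z ->
  (forall w, 0 <= Y w) -> 0 <= s -> {ae P, forall w, Z w <= s} ->
  P.-integrable setT (EFin \o Y) /\ (\int[P]_w (Y w)%:E <= s%:E)%E.
Proof.
move=> cYZ Y0 s0 Zs; have mY := cond_exp_measurable cYZ.
suff le_s : (\int[P]_w (Y w)%:E <= s%:E)%E.
  split=> //; apply/integrableP; split; first exact/measurable_EFinP.
  rewrite (eq_integral (fun w => (Y w)%:E)) => [|w _]; last by rewrite /= ger0_norm.
  by rewrite (le_lt_trans le_s)// ltry.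
have [_ [D [FD UD iD]] condZ] := cYZ.
have {FD UD iD}[D' [tD FD UD iD]] := disjoint_cover Gm FD UD iD.
have mD i : measurable (D' i) by apply: (gen_measurable Gm); exact: FD.
have -> : s%:E = (\int[P]_(w in \bigcup_i D' i) (cst s%:E w))%E.
  by rewrite UD integral_cst//= probability_setT mule1.
rewrite -UD ge0_integral_bigcup//; last first.
- by move=> w _; rewrite lee_fin.
- by rewrite UD; exact/measurable_EFinP.
rewrite ge0_integral_bigcup//.
apply: lee_nneseries => [i _ _|i _].
  by apply: integral_ge0 => w _; rewrite lee_fin.
have [iZ <-] := condZ _ (FD i) (iD i).
have mZ : measurable_fun (D' i) Z by apply/measurable_EFinP; exact: measurable_int iZ.
(* The version Z may be negative somewhere, whereas the almost-everywhere comparison wants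
   nonnegative functions. *)
apply: (@le_trans _ _ (\int[P]_(w in D' i) (Z^\+ w)%:E)%E).
  apply: le_integral => //; first exact: integrable_funrpos.
  by move=> w _; rewrite lee_fin /funrpos le_max lexx.
apply: ae_ge0_le_integral => //.
- by move=> w _; rewrite lee_fin.
- exact/measurable_EFinP/measurable_funrpos.
- by apply: filterS Zs => w Zw _; rewrite lee_fin /funrpos ge_max Zw.
Qed.

End conditional_moments.

(** * Bounds on means and square-integrability *)

Section mean_bound.
Context {R : realType} {d : measure_display} {Om : measurableType d}.
Variable P : probability Om R.
Implicit Types (g h : Om -> R) (a b : R).

(** Integrability is part of the notion so that such bounds can be added and scaled. *)
Definition mean_le g a :=
  P.-integrable setT (EFin \o g) /\ (\int[P]_w (g w)%:E <= a%:E)%E.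

Lemma mean_leD g h a b : mean_le g a -> mean_le h b ->
  mean_le (fun w => g w + h w) (a + b).
Proof.
move=> [ig ga] [ih hb]; split; first exact: (integrableD measurableT ig ih).
under eq_integral do rewrite EFinD.
by rewrite integralD// EFinD leeD.
Qed.

Lemma mean_leZ g a b : 0 <= b -> mean_le g a -> mean_le (fun w => b * g w) (b * a).
Proof.
move=> b0 [ig ga]; split; first exact: (integrableZl measurableT b ig).
under eq_integral do rewrite EFinM.
by rewrite integralZl// EFinM lee_wpmul2l.
Qed.

Lemma mean_le_cst a : mean_le (fun=> a) a.
Proof.
split; first exact: finite_measure_integrable_cst.
by rewrite integral_cst//= probability_setT mule1.
Qed.

Lemma mean_leW g a b : a <= b -> mean_le g a -> mean_le g b.
Proof. by move=> ab [ig ga]; split=> //; rewrite (le_trans ga)// lee_fin. Qed.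

Lemma mean_le_eq g h a : g =1 h -> mean_le g a -> mean_le h a.
Proof. by move=> /funext ->. Qed.

(** Measurability of g is a separate clause because that of g^2 does not imply it. *)
Definition square_integrable g :=
  measurable_fun setT g /\ P.-integrable setT (fun w => (g w ^+ 2)%:E).

Lemma square_integrableM g h : square_integrable g -> square_integrable h ->
  P.-integrable setT (fun w => (g w * h w)%:E).
Proof.
move=> [mg ig] [mh ih].
have igh := integrableD measurableT ig ih.
apply: le_integrable igh => //; first exact/measurable_EFinP/measurable_funM.
move=> w _; rewrite /= lee_fin ler_norml ger0_norm ?addr_ge0 ?sqr_ge0//.
have := sqr_ge0 (g w + h w); have := sqr_ge0 (g w - h w).
have := sqr_ge0 (g w); have := sqr_ge0 (h w).
by rewrite !expr2 => ? ? ? ?; apply/andP; split; lra.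
Qed.

Lemma square_integrable_cst a : square_integrable (fun=> a).
Proof. by split=> //; exact: finite_measure_integrable_cst. Qed.

Lemma square_integrable_dom g h : measurable_fun setT g ->
  P.-integrable setT (EFin \o h) -> (forall w, g w ^+ 2 <= h w) ->
  square_integrable g.
Proof.
move=> mg ih gh; split=> //; apply: le_integrable ih => //.
  exact/measurable_EFinP/measurable_funX.
move=> w _; rewrite /= lee_fin ger0_norm ?sqr_ge0//.
exact: le_trans (gh w) (ler_norm _).
Qed.

Lemma square_integrable_integrable g : square_integrable g ->
  P.-integrable setT (EFin \o g).
Proof.
move=> sg; have := square_integrableM sg (square_integrable_cst 1).
by apply: eq_integrable => // w _; rewrite mulr1.
Qed.

Lemma square_integrableD g h : square_integrable g -> square_integrable h ->
  square_integrable (fun w => g w + h w).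
Proof.
move=> sg sh; have [[mg ig] [mh ih]] := (sg, sh).
have i2 := integrableD measurableT (integrableZl measurableT 2 ig) (integrableZl measurableT 2 ih).
apply: (@square_integrable_dom _ (fun w => 2 * g w ^+ 2 + 2 * h w ^+ 2)) => //.
- exact: measurable_funD.
- move=> w; have := sqr_ge0 (g w - h w); rewrite !expr2; lra.
Qed.

Lemma square_integrableZ a g : square_integrable g ->
  square_integrable (fun w => a * g w).
Proof.
move=> [mg ig]; split; first exact: measurable_funM.
have := integrableZl measurableT (a ^+ 2) ig.
by apply: eq_integrable => // w _; rewrite exprMn EFinM.
Qed.

End mean_bound.

(** * Expectations along a run *)

Section damped_average.
Context {R : realType}.
Implicit Types (w : R) (e : nat -> R).

Lemma damped_cst w (a : R) t : damped w (fun=> a) t = (1 - (1 - w) ^+ t) * a.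
Proof.
elim: t => [|t IH] /=; first by rewrite expr0 subrr mul0r.
by rewrite IH exprS; ring.
Qed.

Lemma mean_le_damped {d : measure_display} {Om : measurableType d}
    (P : probability Om R) w (e : nat -> Om -> R) (a : nat -> R) t :
  0 <= w <= 1 ->
  (forall s, (0 < s <= t)%N -> mean_le P (e s) (a s)) ->
  mean_le P (fun v => damped w (e^~ v) t) (damped w a t).
Proof.
move=> /andP[w0]; rewrite -subr_ge0 => w1.
elim: t => [_|t IH he]; first exact: mean_le_cst.
apply: mean_leD; apply: mean_leZ => //; last by apply: he; rewrite ltnSn.
by apply: IH => s /andP[s0 st]; apply: he; rewrite s0 ltnW.
Qed.

End damped_average.

Section random_rows.
Context {R : realType} {d : measure_display} {Om : measurableType d} {n : nat}.
Variables (P : probability Om R).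
Implicit Types (u v : Om -> 'rV[R]_n) (z : 'rV[R]_n).

Definition square_integrable_row u :=
  forall i, square_integrable P (fun w => u w 0 i).

Lemma square_integrable_row_comb (a b : R) u v :
  square_integrable_row u -> square_integrable_row v ->
  square_integrable_row (fun w => a *: u w + b *: v w).
Proof.
move=> su sv i.
have := square_integrableD (square_integrableZ a (su i)) (square_integrableZ b (sv i)).
by congr square_integrable; apply/funext => w; rewrite !mxE.
Qed.

Lemma measurable_wrt_row_comb (G : set (set Om)) (a b : R) u v :
  measurable_wrt <<s G>> u -> measurable_wrt <<s G>> v ->
  measurable_wrt <<s G>> (fun w => a *: u w + b *: v w).
Proof.
move=> mu mv; apply: measurable_wrt_row => i; apply/measurable_wrtP.
have /measurable_wrtP mui := measurable_wrt_coord i mu.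
have /measurable_wrtP mvi := measurable_wrt_coord i mv.
rewrite (_ : (fun w => _) = (fun w => a * u w 0 i + b * v w 0 i)); last first.
  by apply/funext => w; rewrite !mxE.
by apply: measurable_funD; apply: measurable_funM.
Qed.

Variables (nrm : 'rV[R]_n -> R) (hn : is_norm nrm).

Lemma sqr_nrm_dominated u z : square_integrable_row u ->
  exists2 h : Om -> R, P.-integrable setT (EFin \o h) &
    forall w, nrm (u w - z) ^+ 2 <= h w.
Proof.
move=> su; have [K K0 nK] := nrm_ub hn.
exists (fun w => K ^+ 2 * (\sum_(i < n) (u w 0 i + - z 0 i) ^+ 2)).
  apply: (integrableZl measurableT (K ^+ 2)
    (f := fun w => (\sum_(i < n) (u w 0 i + - z 0 i) ^+ 2)%:E)).
  under eq_fun do rewrite -sumEFin.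
  apply: integrable_sum => // i _.
  by have [] := square_integrableD (su i) (square_integrable_cst P (- z 0 i)).
move=> w; set x := u w - z.
have -> : \sum_(i < n) (u w 0 i + - z 0 i) ^+ 2 = \sum_(i < n) x 0 i ^+ 2.
  by apply: eq_bigr => i _; rewrite !mxE.
have xs : `|x| ^+ 2 <= \sum_(i < n) x 0 i ^+ 2.
  have s0 : 0 <= \sum_(i < n) x 0 i ^+ 2 by rewrite sumr_ge0// => i _; rewrite sqr_ge0.
  rewrite -[leRHS]sqr_sqrtr// ler_sqr ?nnegrE ?sqrtr_ge0//.
  apply: norm_le_coord; rewrite ?sqrtr_ge0// => i.
  rewrite -sqrtr_sqr ler_sqrt// (bigD1 i)//= lerDl sumr_ge0// => j _.
  exact: sqr_ge0.
apply: le_trans (ler_wpM2l (sqr_ge0 K) xs).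
by rewrite -exprMn ler_sqr ?nnegrE ?(nrm_ge0 hn)// mulr_ge0// ltW.
Qed.

Lemma square_integrable_row_dom u z (h : Om -> R) :
  (forall i, measurable_fun setT (fun w => u w 0 i)) ->
  P.-integrable setT (EFin \o h) ->
  (forall w, nrm (u w - z) ^+ 2 <= h w) -> square_integrable_row u.
Proof.
move=> mu ih uh i; have [K K0 nK] := nrm_lb hn.
have ih2 := integrableD measurableT (integrableZl measurableT (2 * K ^+ 2) ih)
  (finite_measure_integrable_cst P (2 * z 0 i ^+ 2) measurableT).
apply: (square_integrable_dom (h := fun w => 2 * K ^+ 2 * h w + 2 * z 0 i ^+ 2)) => //.
move=> w.
have h1 : `|(u w - z) 0 i| <= K * nrm (u w - z).
  by rewrite (le_trans (coord_le_norm _ _)).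
have h2 : (u w 0 i - z 0 i) ^+ 2 <= K ^+ 2 * nrm (u w - z) ^+ 2.
  move: h1; rewrite !mxE -exprMn => h1; rewrite -[leLHS]real_normK ?num_real//.
  by rewrite ler_sqr ?nnegrE// mulr_ge0 ?(nrm_ge0 hn)// ltW.
have h3 := ler_wpM2l (sqr_ge0 K) (uh w).
have := sqr_ge0 (u w 0 i - 2 * z 0 i); move: h2 h3; rewrite !expr2; lra.
Qed.

Variables (G : set (set Om)) (Gm : G `<=` measurable).
Variables (g hu u : Om -> 'rV[R]_n) (Z : Om -> R) (sigma : R).
Hypothesis cond_mean : forall i, is_cond_exp P <<s G>> (fun w => g w 0 i) (fun w => hu w 0 i).
Hypothesis cond_var :
  is_cond_exp P <<s G>> (fun w => dual_norm nrm (g w - hu w) ^+ 2) Z.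
Hypothesis var_le : {ae P, forall w, Z w <= sigma ^+ 2}.
Hypotheses (mu : measurable_wrt <<s G>> u) (su : square_integrable_row u).

Lemma noise_square_integrable :
  mean_le P (fun w => dual_norm nrm (g w - hu w) ^+ 2) (sigma ^+ 2).
Proof.
apply: cond_exp_le cond_var _ _ var_le => // [w|]; exact: sqr_ge0.
Qed.

Lemma noise_mean_zero z :
  P.-integrable setT (fun w => (dotv (g w - hu w) (z - u w))%:E) /\
  (\int[P]_w (dotv (g w - hu w) (z - u w))%:E = 0)%E.
Proof.
pose delta i w := g w 0 i - hu w 0 i; pose zeta i w := z 0 i - u w 0 i.
have sz i : square_integrable P (zeta i).
  have := square_integrableD (square_integrable_cst P (z 0 i)) (square_integrableZ (-1) (su i)).
  by congr square_integrable; apply/funext => w; rewrite mulN1r.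
have sd i : square_integrable P (delta i).
  have := integrableZl measurableT (nrm (delta_mx 0 i) ^+ 2) noise_square_integrable.1.
  move/(square_integrable_dom (g := delta i)
    (h := fun w => nrm (delta_mx 0 i) ^+ 2 * dual_norm nrm (g w - hu w) ^+ 2)); apply.
    apply: measurable_funB; first exact: (cond_exp_measurable Gm (cond_mean i)).
    have [/measurable_wrtP + _ _] := cond_mean i.
    exact: measurable_fun_gen.
  move=> w; have := coord_le_dual hn (g w - hu w) i; rewrite !mxE => hw.
  rewrite -[leLHS]real_normK ?num_real// mulrC -exprMn ler_sqr ?nnegrE//.
  by rewrite mulr_ge0 ?(nrm_ge0 hn) ?(dual_norm_ge0 hn).
have idz i : P.-integrable setT (fun w => (delta i w * zeta i w)%:E).
  exact: square_integrableM.
have E : (fun w => (dotv (g w - hu w) (z - u w))%:E)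
    = (fun w => (\sum_(i < n) (delta i w * zeta i w)%:E)%E).
  by apply/funext => w; rewrite sumEFin; congr EFin; apply: eq_bigr => i _; rewrite !mxE.
rewrite E; split; first exact: integrable_sum.
rewrite integral_sum// big1// => i _.
apply: (centered_orthogonal Gm (g := delta i) (zeta := zeta i)) => //.
- exact: (square_integrable_integrable (sd i)).
- move=> A FA; apply: (cond_exp_centered Gm (cond_mean i)) => //.
  exact: (square_integrable_integrable (sd i)).
- apply/measurable_wrtP; apply: measurable_funB => //.
  by have /measurable_wrtP := measurable_wrt_coord i mu.
Qed.

Lemma noise_mean_le (M K : R) z : 0 < K ->
  mean_le P (fun w => dotv (g w - hu w) (z - u w)
     + (M ^+ 2 + dual_norm nrm (g w - hu w) ^+ 2) / K)
    ((M ^+ 2 + sigma ^+ 2) / K).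
Proof.
move=> K0; have [i0 e0] := noise_mean_zero z.
have h0 : mean_le P (fun w => dotv (g w - hu w) (z - u w)) 0 by rewrite /mean_le e0.
have k0 : 0 <= K^-1 by rewrite invr_ge0 ltW.
have := mean_leD h0 (mean_leZ k0 (mean_leD (mean_le_cst P (M ^+ 2)) noise_square_integrable)).
by rewrite add0r mulrC; apply: mean_le_eq => w; rewrite [in RHS]mulrC.
Qed.

End random_rows.

(** * Adaptedness of the iterates and noise of an epoch *)

Section run.
Context {R : realType} {d : measure_display} {Om : measurableType d}.
Context {d' : measure_display} {Xi : measurableType d'} {n : nat}.
Variables (P : probability Om R).
Variables (X : set 'rV[R]_n) (nrm : 'rV[R]_n -> R) (nu mu L M : R).
Variables (om f h chi : 'rV[R]_n -> R) (gom gf h' : 'rV[R]_n -> 'rV[R]_n).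
Hypothesis pb : composite_problem X nrm nu mu L M om f h chi gom gf h'.
Hypothesis clX : closed X.
Local Notation V := (bregman om gom).
Local Notation Psi := (fun z => f z + h z + chi z).

Variables (H : 'rV[R]_n -> Xi -> 'rV[R]_n) (xi : nat -> nat -> {RV P >-> Xi}).
Variables (sigma : R) (N : nat) (T : nat -> nat).
Hypothesis mH : measurable_oracle X H.
Hypothesis oracle : forall k t : nat, (1 <= k <= N)%N -> (1 <= t <= T k)%N ->
  unbiased_bounded_variance xi X nrm h' H sigma N T k t.

(** The generating family of [past], named because the measurability lemmas are stated for [<<s G>>]
    in terms of G. *)
Definition past_generator k t : set (set Om) :=
  \bigcup_(i in [set i | sample_index N T i /\ drawn_before i (k, t)])
    preimage_set_system setT (xi i.1 i.2) measurable.
Local Notation gen := past_generator.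

Lemma past_generator_measurable k t : gen k t `<=` measurable.
Proof.
move=> A [i _ [B mB <-]].
exact: (measurable_funP (xi i.1 i.2) measurableT _ mB).
Qed.

Lemma past_generatorS k t k' t' :
  (forall i, sample_index N T i -> drawn_before i (k, t) -> drawn_before i (k', t')) ->
  <<s gen k t>> `<=` <<s gen k' t'>>.
Proof.
move=> kt; apply: sub_sigma_algebra2 => A [i [iT ikt] Ai]; exists i => //.
by split=> //; exact: kt.
Qed.

Lemma past_next_sample k t : <<s gen k t>> `<=` <<s gen k t.+1>>.
Proof.
apply: past_generatorS => i _; rewrite /drawn_before /= => /orP[->//|/andP[-> it]].
by rewrite ltnS (ltnW it) orbT.
Qed.

Lemma past_next_epoch k : <<s gen k (T k).+1>> `<=` <<s gen k.+1 1>>.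
Proof.
apply: past_generatorS => i _; rewrite /drawn_before /= => /orP[ik|/andP[/eqP-> _]].
  by rewrite (ltn_trans ik).
by rewrite ltnSn.
Qed.

(** The properties travel together: the oracle condition applies only to past-measurable points of
    X, and the moment it yields gives square-integrability of the next point. *)
Definition adapted (G : set (set Om)) (v : Om -> 'rV[R]_n) :=
  [/\ measurable_wrt <<s G>> v, (forall w, X (v w)) & square_integrable_row P v].

Lemma adaptedS G1 G2 v : <<s G1>> `<=` <<s G2>> -> adapted G1 v -> adapted G2 v.
Proof. by move=> G12 [mv Xv sv]; split=> //; exact: measurable_wrtS mv. Qed.

Lemma adapted_comb G (a : R) v1 v2 : 0 <= a <= 1 -> adapted G v1 -> adapted G v2 ->
  adapted G (fun w => (1 - a) *: v1 w + a *: v2 w).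
Proof.
move=> a01 [m1 X1 s1] [m2 X2 s2]; split.
- exact: measurable_wrt_row_comb.
- by move=> w; apply: convex_setE (cp_convex_set pb) _ _ _.
- exact: square_integrable_row_comb.
Qed.

Lemma adapted_cst G z : X z -> adapted G (fun=> z).
Proof.
move=> Xz; split=> // [|i]; last exact: square_integrable_cst.
apply: measurable_wrt_row => i; apply/measurable_wrtP.
exact: measurable_cst.
Qed.

Lemma closed_measurable_row :
  measurable (X : set (g_sigma_algebraType (@open 'rV[R]_n))).
Proof.
rewrite -(setCK X); apply: measurableC; apply: sub_sigma_algebra.
exact: closed_openC.
Qed.

Lemma oracle_measurable k t v : (1 <= k <= N)%N -> (1 <= t <= T k)%N ->
  adapted (gen k t) v ->
  measurable_wrt <<s gen k t.+1>> (fun w => H (v w) (xi k t w)).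
Proof.
move=> kN tT [mv Xv _]; apply: measurable_wrt_row => i; apply/measurable_wrtP.
pose pair (w : g_sigma_algebraType (gen k t.+1)) :=
  (v w : g_sigma_algebraType (@open 'rV[R]_n), xi k t w).
apply: (@measurable_comp _ _ _ _ _ _
  ((X : set (g_sigma_algebraType (@open 'rV[R]_n))) `*` [set: Xi])
  (fun z => H z.1 z.2 0 i) setT pair).
- by apply: measurableX => //; exact: closed_measurable_row.
- by move=> _ [w _ <-]; split=> //=; exact: Xv.
- exact: mH.
apply: measurable_fun_pair => [_ B mB|_ B mB]; rewrite setTI.
  by apply: past_next_sample; exact: mv.
apply: sub_sigma_algebra; exists (k, t).
  by split=> //; rewrite /drawn_before /= eqxx ltnSn orbT.
by exists B => //; rewrite setTI.
Qed.

Lemma prox_measurable G (b q : R) (y x u' g u : Om -> 'rV[R]_n) :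
  0 <= b -> 0 <= q -> adapted G y -> adapted G x -> adapted G u' ->
  measurable_wrt <<s G>> g ->
  (forall w, is_argmin X
    (prox_objective om chi gom f gf b q (y w) (x w) (u' w) (g w)) (u w)) ->
  measurable_wrt <<s G>> u.
Proof.
move=> b0 q0 [my Xy _] [mx Xx _] [mu' Xu' _] mg umin.
have hn := cp_norm pb; have mu0 := cp_mu pb.
pose slope w := prox_slope gom gf b q (y w) (x w) (u' w) (g w).
have mslope : measurable_wrt <<s G>> slope.
  have m1 := measurable_wrt_continuous_within (cp_gf pb).2 Xy my.
  have m2 := measurable_wrt_continuous_within (cp_om pb).1.2 Xx mx.
  have m3 := measurable_wrt_continuous_within (cp_om pb).1.2 Xu' mu'.
  have m4 := measurable_wrt_row_comb (-b) (-q) m2 m3.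
  have m5 := measurable_wrt_row_comb 1 1 m1 mg.
  have := measurable_wrt_row_comb 1 1 m5 m4.
  congr measurable_wrt; apply/funext => w; rewrite /slope /prox_slope !scale1r !scaleNr.
  by rewrite !addrA.
have [K1 K10 nK1] := nrm_lb hn; have [K2 K20 nK2] := dual_norm_ub hn.
apply: (measurable_wrt_factor _ mslope) => w e e0.
(* K1 and K2 translate [nrm] and its dual into the library norm; mu^-1 is the Lipschitz constant of
   the argmin. *)
exists (e * mu / (K1 * K2)); first by rewrite divr_gt0 ?mulr_gt0.
move=> w'; rewrite ltr_pdivlMr ?mulr_gt0// => hw.
have bq : 0 <= b + q by rewrite addr_ge0.
have := prox_lipschitz (cp_convex_set pb) hn (cp_om pb) (cp_chi pb) (cp_chi_strong pb)
  bq (ltW (cp_nu pb)) (prox_objective_argmin (umin w)) (prox_objective_argmin (umin w')).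
move=> /le_trans /(_ (nK2 _)) hl.
rewrite -(ltr_pM2r mu0); apply: le_lt_trans hw.
have h1 := nK1 (u w - u w').
have := ler_wpM2r (ltW mu0) h1; have := ler_wpM2l (ltW K10) hl.
rewrite -/(slope w) -/(slope w'); lra.
Qed.

Variables (x0 xs : 'rV[R]_n) (b gam : R) (rho : nat -> R) (p theta : nat -> nat -> R).
Variables (x xt xb xu : nat -> Om -> 'rV[R]_n) (u ut : nat -> nat -> Om -> 'rV[R]_n).
Hypothesis algo : rf_sgs X f chi om gf gom H (fun k t => xi k t) x0 N
  (fun=> b) (fun=> gam) T p theta x xt xb xu u ut.
Hypotheses (Xx0 : X x0) (xs_min : is_argmin X Psi xs).
Hypotheses (b0 : 0 < b) (gam01 : 0 <= gam <= 1) (gamb : L * gam / nu <= b).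
Hypotheses (rho0 : forall k, 0 < rho k) (T0 : forall k, (0 < T k)%N).
Hypothesis pE : forall k t, rho k * (b * p k t) = b + mu.
Hypothesis thetaE : forall k t,
  theta k t = (1 - 1 / (1 + rho k)) / (1 - 1 / (1 + rho k) ^+ t).

Let mu0 := cp_mu pb.
Let bm0 : 0 < b + mu := addr_gt0 b0 mu0.

(** The common value of b * p k t over the epoch. The theorem takes rho k = r^k, so q k grows like
    r^-k and the noise level, proportional to 1 / q k, decays like r^k. *)
Let q k := (b + mu) / rho k.
Let q0 k : 0 < q k := divr_gt0 bm0 (rho0 k).
Let pq k t : b * p k t = q k.
Proof. by rewrite /q -(pE k t) mulrAC mulfV ?mul1r ?gt_eqF. Qed.

Let g k t w := H (u k t.-1 w) (xi k t w).

Lemma run_argmin k t w : (1 <= k <= N)%N -> (t < T k)%N ->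
  is_argmin X (prox_objective om chi gom f gf b (q k) (xu k w) (x k.-1 w)
    (u k t w) (g k t.+1 w)) (u k t.+1 w).
Proof. by move=> kN tT; have := rf_u algo (k := k) (t := t.+1) w kN tT; rewrite pq. Qed.

Lemma average_weight01 k t : (0 < t)%N -> 0 <= theta k t <= 1.
Proof.
move=> t0; rewrite thetaE !div1r; have r1 : 1 < 1 + rho k by rewrite ltrDl.
have r0 : 0 < 1 + rho k by rewrite (lt_trans ltr01).
have d0 : 0 < 1 - (1 + rho k) ^- t.
  by rewrite subr_gt0 invf_lt1 ?exprn_gt0// exprn_egt1// -lt0n.
rewrite divr_ge0 ?(ltW d0) ?subr_ge0 ?invf_le1 ?(ltW r1)//=.
rewrite ler_pdivrMr// mul1r lerD2l lerN2 lef_pV2 ?posrE ?exprn_gt0//.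
by rewrite -[leLHS]expr1 ler_eXn2l.
Qed.

(** The index t.+1 of the past reflects that [u k t] already depends on the sample [xi k t]. *)
Lemma inner_adapted k : (1 <= k <= N)%N ->
  adapted (gen k 1) (x k.-1) -> adapted (gen k 1) (xb k.-1) ->
  forall t, (t <= T k)%N ->
  adapted (gen k t.+1) (u k t) /\ adapted (gen k t.+1) (ut k t).
Proof.
move=> kN ax axb; elim=> [_|t IH tT].
  rewrite (_ : u k 0 = x k.-1); last by apply/funext => w; rewrite (rf_u0 algo).
  by rewrite (_ : ut k 0 = x k.-1)//; apply/funext => w; rewrite (rf_ut0 algo).
have [au aut] := IH (ltnW tT).
have mono s : <<s gen k 1>> `<=` <<s gen k s.+1>>.
  by elim: s => // s IHs A /IHs; exact: past_next_sample.
have ax2 := adaptedS (mono t.+1) ax; have axb2 := adaptedS (mono t.+1) axb.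
have au2 := adaptedS (@past_next_sample k t.+1) au.
have axu : adapted (gen k t.+2) (xu k).
  rewrite (_ : xu k = fun w => (1 - gam) *: xb k.-1 w + gam *: x k.-1 w).
    exact: adapted_comb.
  by apply/funext => w; rewrite (rf_xu algo).
have mg := oracle_measurable kN (t := t.+1) tT au.
have amin w := run_argmin w kN tT.
have mu_ : measurable_wrt <<s gen k t.+2>> (u k t.+1).
  exact: prox_measurable (ltW b0) (ltW (q0 k)) axu ax2 au2 mg amin.
have aS : adapted (gen k t.+2) (u k t.+1).
  split=> //; first by move=> w; have [] := amin w.
  have [K K0 hK] := inner_iterate_bound pb (ltW b0) (q0 k) xs_min.
  have [[muk Xu su] [_ Xxu sxu]] := (au, axu); have [_ Xx sx] := ax2.
  have [cm [Z cv Zle]] := oracle kN (t := t.+1) tT muk Xu.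
  have [iD _] := noise_square_integrable (@past_generator_measurable k t.+1) cv Zle.
  have [h1 ih1 hh1] := sqr_nrm_dominated (cp_norm pb) xs su.
  have [h2 ih2 hh2] := sqr_nrm_dominated (cp_norm pb) xs sxu.
  have [h3 ih3 hh3] := sqr_nrm_dominated (cp_norm pb) xs sx.
  have i1 := finite_measure_integrable_cst P (1 : R) measurableT.
  have isum := integrableD measurableT (integrableD measurableT (integrableD measurableT
    (integrableD measurableT i1 iD) ih1) ih2) ih3.
  apply: (@square_integrable_row_dom _ _ _ _ P _ (cp_norm pb) _ xs
    (fun w => K * (1 + dual_norm nrm (H (u k t w) (xi k t.+1 w) - h' (u k t w)) ^+ 2
       + h1 w + h2 w + h3 w))).
  - move=> i; have /measurable_wrtP := measurable_wrt_coord i mu_.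
    exact: measurable_fun_gen (@past_generator_measurable _ _) .
  - exact: (integrableZl measurableT K isum).
  - move=> w; apply: le_trans (hK _ _ _ _ _ (Xxu w) (Xx w) (Xu w) (amin w)) _.
    by rewrite ler_wpM2l// !lerD.
split=> //; rewrite (_ : ut k t.+1 = fun w => (1 - theta k t.+1) *: ut k t w
    + theta k t.+1 *: u k t.+1 w); last first.
  by apply/funext => w; rewrite (rf_ut algo).
apply: adapted_comb => //; first exact: average_weight01.
exact: adaptedS (@past_next_sample k t.+1) aut.
Qed.

Lemma outer_adapted k : (k <= N)%N ->
  adapted (gen k.+1 1) (x k) /\ adapted (gen k.+1 1) (xb k).
Proof.
elim: k => [_|k IH kN].
  rewrite (_ : x 0%N = fun=> x0); last by apply/funext => w; rewrite (rf_x0 algo).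
  rewrite (_ : xb 0%N = fun=> x0); last by apply/funext => w; rewrite (rf_xb0 algo).
  by split; exact: adapted_cst.
have kN' : (1 <= k.+1 <= N)%N by [].
have [ax axb] := IH (ltnW kN).
have [au aut] := inner_adapted kN' ax axb (leqnn (T k.+1)).
have mono s : <<s gen k.+1 1>> `<=` <<s gen k.+1 s.+1>>.
  by elim: s => // s IHs A /IHs; exact: past_next_sample.
have toS := adaptedS (@past_next_epoch k.+1).
split.
  rewrite (_ : x k.+1 = u k.+1 (T k.+1)); first exact: toS.
  by apply/funext => w; rewrite (rf_x algo).
rewrite (_ : xb k.+1 = fun w => (1 - gam) *: xb k w + gam *: ut k.+1 (T k.+1) w).
  by apply: adapted_comb => //; [exact: toS (adaptedS (mono _) axb)|exact: toS].
by apply/funext => w; rewrite (rf_xb algo)// (rf_xt algo).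
Qed.

Lemma run_adapted k t : (k < N)%N -> (t <= T k.+1)%N ->
  adapted (gen k.+1 t.+1) (u k.+1 t) /\ adapted (gen k.+1 t.+1) (ut k.+1 t).
Proof.
move=> kN tT; have [ax axb] := outer_adapted (ltnW kN).
exact: inner_adapted.
Qed.

Definition inner_noise k t w : R :=
  dotv (g k t w - h' (u k t.-1 w)) (xs - u k t.-1 w)
  + (M ^+ 2 + dual_norm nrm (g k t w - h' (u k t.-1 w)) ^+ 2) / (nu * q k).

Lemma inner_noise_mean_le k t : (k < N)%N -> (0 < t <= T k.+1)%N ->
  mean_le P (inner_noise k.+1 t) ((M ^+ 2 + sigma ^+ 2) / (nu * q k.+1)).
Proof.
case: t => // t kN /andP[_ tT].
have [[mu_ Xu su] _] := run_adapted kN (ltnW tT).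
have [cm [Z cv Zle]] := oracle (k := k.+1) kN (t := t.+1) tT mu_ Xu.
apply: (noise_mean_le (cp_norm pb) (@past_generator_measurable k.+1 t.+1) cm cv Zle mu_ su).
by rewrite mulr_gt0 ?(cp_nu pb).
Qed.

Definition epoch_weight k : R := (1 + rho k) ^- T k.

Lemma epoch_weight_lt1 k : 0 < 1 - epoch_weight k.
Proof.
rewrite subr_gt0 invf_lt1 ?exprn_gt0 ?exprn_egt1 -?lt0n ?ltrDl//.
by rewrite addr_gt0.
Qed.

(** The damping weights of the epoch add up to 1 - W, so this quotient is a true average and keeps
    the mean bound of a single step. *)
Definition epoch_noise k w : R :=
  damped (rho k / (1 + rho k)) (fun t => inner_noise k t w) (T k) / (1 - epoch_weight k).

Lemma epoch_noise_mean_le k : (k < N)%N ->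
  mean_le P (epoch_noise k.+1) ((M ^+ 2 + sigma ^+ 2) / (nu * q k.+1)).
Proof.
move=> kN; set a := _ / _.
have r1 : 0 < 1 + rho k.+1 by rewrite addr_gt0.
have w01 : 0 <= rho k.+1 / (1 + rho k.+1) <= 1.
  by rewrite divr_ge0 ?(ltW r1) ?(ltW (rho0 _))//= ler_pdivrMr// mul1r lerDr.
have := mean_le_damped w01 (fun s => @inner_noise_mean_le k s kN).
rewrite damped_cst -/a (_ : 1 - _ / _ = (1 + rho k.+1)^-1); last first.
  by field; rewrite gt_eqF.
rewrite exprVn => hd.
have i0 : 0 <= (1 - epoch_weight k.+1)^-1 by rewrite invr_ge0 ltW ?epoch_weight_lt1.
have := mean_leZ i0 hd; rewrite mulKf ?gt_eqF ?epoch_weight_lt1//.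
by apply: mean_le_eq => w; rewrite mulrC.
Qed.

Lemma run_in_set k w : (k <= N)%N -> X (x k w) /\ X (xb k w).
Proof. by move=> /outer_adapted[[_ Xx _] [_ Xxb _]]. Qed.

Lemma outer_descent k w : (k < N)%N ->
  Psi (xb k.+1 w) - Psi xs <= (1 - gam) * (Psi (xb k w) - Psi xs) + gam *
    ((epoch_weight k.+1 / (1 - epoch_weight k.+1) * (b + mu) + b) * V (x k w) xs
     - (b + mu) * (1 - epoch_weight k.+1)^-1 * V (x k.+1 w) xs
     + epoch_noise k.+1 w).
Proof.
move=> kN; have [Xx Xxb] := run_in_set w (ltnW kN).
have kN' : (1 <= k.+1 <= N)%N by [].
have Xs := xs_min.1.
have [_ [_ Xut _]] := run_adapted kN (leqnn _).
have h1 := outer_step pb (ltW b0) gam01 gamb Xxb Xx (Xut w).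
have xbE : xb k.+1 w = (1 - gam) *: xb k w + gam *: ut k.+1 (T k.+1) w.
  by rewrite (rf_xb algo)// (rf_xt algo).
have xuE : xu k.+1 w = (1 - gam) *: xb k w + gam *: x k w by rewrite (rf_xu algo).
rewrite -xbE -xuE in h1.
have Xy : X (xu k.+1 w).
  by rewrite xuE; exact: convex_setE (cp_convex_set pb) _ _ _.
have h2 := inner_model_le pb b (x k w) Xy Xs.
have u0 : u k.+1 0%N w = x k w by rewrite (rf_u0 algo).
have ut0 : ut k.+1 0%N w = x k w by rewrite (rf_ut0 algo).
have rq : rho k.+1 * q k.+1 = b + mu by rewrite mulrC divfK ?gt_eqF.
have [||||_ _] := inner_loop (z := xs) (y := xu k.+1 w) (x := x k w) (T := T k.+1)
  (u := fun t => u k.+1 t w) (ut := fun t => ut k.+1 t w) (g := fun t => g k.+1 t w)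
  pb (ltW b0) (q0 k.+1) (rho0 k.+1) rq Xs _ _ _ _ (leqnn _).
- by rewrite u0.
- by rewrite ut0.
- by move=> t tT; exact: run_argmin.
- by move=> t tT /=; rewrite (rf_ut algo)// thetaE.
rewrite u0 -/(epoch_weight k.+1) -(rf_x algo)//.
have d0 := epoch_weight_lt1 k.+1.
have -> : damped (rho k.+1 / (1 + rho k.+1)) (fun t =>
     dotv (g k.+1 t w - h' (u k.+1 t.-1 w)) (xs - u k.+1 t.-1 w)
     + (M ^+ 2 + dual_norm nrm (g k.+1 t w - h' (u k.+1 t.-1 w)) ^+ 2) / (nu * q k.+1)) (T k.+1)
   = (1 - epoch_weight k.+1) * epoch_noise k.+1 w.
  by rewrite [RHS]mulrC /epoch_noise divfK ?gt_eqF.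
move: (epoch_weight k.+1) d0 (epoch_noise k.+1 w) => W d0 e h3.
have {}h3 : inner_model om f h chi gom gf b (xu k.+1 w) (x k w) (ut k.+1 (T k.+1) w)
    - inner_model om f h chi gom gf b (xu k.+1 w) (x k w) xs
  <= W / (1 - W) * (b + mu) * V (x k w) xs - (b + mu) * (1 - W)^-1 * V (x k.+1 w) xs + e.
  rewrite -(ler_pM2l d0).
  have -> : (1 - W) * (W / (1 - W) * (b + mu) * V (x k w) xs
      - (b + mu) * (1 - W)^-1 * V (x k.+1 w) xs + e)
    = W * (b + mu) * V (x k w) xs - (b + mu) * V (x k.+1 w) xs + (1 - W) * e.
    by field; rewrite gt_eqF.
  lra.
have [g0 _] := andP gam01; have := ler_wpM2l g0 h3; have := ler_wpM2l g0 h2.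
lra.
Qed.

End run.

(** * Rate of convergence and complexity *)

Section convergence.
Context {R : realType}.

Lemma Gamma_coef_cst (c : R) k : Gamma_coef (fun=> 1 - c) k = c ^+ k.
Proof. by elim: k => //= k ->; rewrite subKr exprS. Qed.

(** With q = (b + mu) / rho one has 1 - w = q / (b + mu + q) = 1 / (1 + rho), the power that also
    appears in [theta]. *)
Lemma W_coef_geometric (mu rho : R) bet p k t : 0 < rho -> 0 < bet k + mu ->
  (forall s, rho * (bet k * p k s) = bet k + mu) ->
  W_coef mu bet p k t = (1 + rho) ^- t.
Proof.
move=> rho0 bm0 hp; elim: t => [|t IH]; first by rewrite expr0 invr1.
have hp1 : bet k * p k t.+1 = (bet k + mu) / rho.
  by rewrite -(hp t.+1) mulrAC mulfV ?mul1r ?gt_eqF.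
rewrite /= IH exprS invfM; congr (_ * _).
rewrite /w_coef (_ : bet k * (1 + p k t.+1) + mu = bet k + mu + bet k * p k t.+1); last by ring.
move: (bet k + mu) bm0 hp1 => B B0 ->.
by field; rewrite !gt_eqF ?addr_gt0 ?mulr_gt0.
Qed.

(* Psi need not be Borel on the boundary of X, so f is not assumed measurable. *)
Lemma le_integral_ge0 {d : measure_display} {Om : measurableType d}
    (P : probability Om R) (f g : Om -> R) :
  (forall w, 0 <= f w) -> (forall w, f w <= g w) ->
  (\int[P]_w (f w)%:E <= \int[P]_w (g w)%:E)%E.
Proof.
move=> f0 fg; rewrite !ge0_integralTE; last 2 first.
- by move=> w; rewrite lee_fin (le_trans (f0 w)).
- by move=> w; rewrite lee_fin.
apply: le_ereal_sup => _ [s hs <-]; exists s => // w.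
by rewrite (le_trans (hs w))// lee_fin.
Qed.

End convergence.

Unset Implicit Arguments.
Set Strict Implicit.

(* C is the constant of both O(.) bounds: it is universal. *)
Theorem theorem2 (R : realType) :
  exists2 C : R, 0 < C &
  forall (n : nat) (X : set 'rV[R]_n) (nrm : 'rV[R]_n -> R)
    (f h chi om : 'rV[R]_n -> R) (gf h' gom : 'rV[R]_n -> 'rV[R]_n)
    (mu nu L M sigma eps : R) (x0 xs : 'rV[R]_n)
    (d : measure_display) (Om : measurableType d) (P : probability Om R)
    (d' : measure_display) (Xi : measurableType d')
    (H : 'rV[R]_n -> Xi -> 'rV[R]_n) (xi : nat -> nat -> {RV P >-> Xi})
    (x xt xb xu : nat -> Om -> 'rV[R]_n) (u ut : nat -> nat -> Om -> 'rV[R]_n),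
  let V := bregman om gom in
  let Psi : 'rV[R]_n -> R := fun z => f z + h z + chi z in
  let c : R := Num.sqrt (L / (mu * nu)) / (1 + Num.sqrt (L / (mu * nu))) in
  let beta : R := L * (1 - c) / nu in
  let Delta0 : R := Psi x0 - Psi xs in
  let A : R := Delta0 + (beta + mu) * (1 - c) * V x0 xs
           + 2 * (M ^+ 2 + sigma ^+ 2) / (nu * (beta + mu)) in
  let bet : nat -> R := fun _ => beta in
  let gam : nat -> R := fun _ => 1 - c in
  let T : nat -> nat := fun k =>
    absz (Num.ceil (1 / c `^ (k%:R / 2)
                    * ((beta + mu) * (1 - c) / (c * (beta + mu) - beta)))) in
  let N : nat := maxn 1 (absz (Num.ceil (2 * ln (Num.max (A / eps) 1) / ln (1 / c)))) in
  let p : nat -> nat -> R := fun k _ => (beta + mu) / beta * (1 / c `^ (k%:R / 2)) in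
  let theta : nat -> nat -> R := fun k t =>
    (1 - 1 / (1 + c `^ (k%:R / 2))) / (1 - 1 / (1 + c `^ (k%:R / 2)) ^+ t) in
  let Gamma := Gamma_coef gam in
  let W := W_coef mu bet p in
  (* standing assumptions *)
  closed X -> convex_set X -> is_norm nrm ->
  0 < nu -> 0 < mu -> nu * mu <= L -> 0 < M -> 0 <= sigma -> 0 < eps ->
  distance_generating X nrm nu om gom ->
  (forall y z, X y -> X z -> V y z <= 1 / 2 * nrm (y - z) ^+ 2) ->
  X x0 ->
  is_argmin X Psi xs ->
  (* (i) *)
  convex_function X f -> continuously_differentiable_on X f gf ->
  (forall y z, X y -> X z ->
     f z <= f y + dotv (gf y) (z - y) + L / 2 * nrm (z - y) ^+ 2) ->
  convex_function X h -> (forall y, X y -> subdifferential X h y (h' y)) ->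
  (forall y z, X y -> X z ->
     h z <= h y + dotv (h' y) (z - y) + M * nrm (z - y)) ->
  (* (ii) *)
  convex_function X chi -> strongly_convex X nrm mu chi ->
  (* (iii) *)
  measurable_oracle X H -> iid_samples xi N T ->
  (forall k t : nat, (1 <= k <= N)%N -> (1 <= t <= T k)%N ->
     independent_of_past xi N T k t /\
     unbiased_bounded_variance xi X nrm h' H sigma N T k t) ->
  (* (iv) *)
  (forall k : nat, (1 <= k)%N -> L * gam k / nu <= bet k) ->
  (* (v) *)
  (forall k : nat, (2 <= k)%N ->
     gam k * (W k (T k) / (1 - W k (T k)) * (bet k + mu) + bet k) / Gamma k
     <= gam k.-1 * (bet k.-1 + mu)
        / (Gamma k.-1 * (1 - W k.-1 (T k.-1)))) ->
  rf_sgs X f chi om gf gom H (fun k t => xi k t) x0 N bet gam T p theta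
    x xt xb xu u ut ->
  [/\ ('E_P[fun w => (Psi (xb N w) - Psi xs)%R] <= (c `^ (N%:R / 2) * A)%:E)%E,
      ('E_P[fun w => (Psi (xb N w) - Psi xs)%R] <= eps%:E)%E,
      (gradient_evaluations N)%:R
        <= C * (1 + Num.sqrt (L / (nu * mu)) * ln (Num.max 1 (A / eps)))
    & eps <= A ->
      (oracle_evaluations N T)%:R
        <= C * (A * L / (nu * mu * eps)
                + Num.sqrt (L / (nu * mu)) * ln (Num.max 1 (A / eps)))].
Proof.
exists 25 => // n X nrm f h chi om gf h' gom mu nu L M sigma eps x0 xs d Om P d' Xi
  H xi x xt xb xu u ut V Psi c beta Delta0 A bet gam T N p theta Gamma W.
move=> clX cX hn nu0 mu0 muL M0 sigma0 eps0 hom Vle Xx0 xs_min cf cgf fL ch hsub hM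
  cchi schi mH _ oracle _ weights algo.
have L0 : 0 < L := lt_le_trans (mulr_gt0 nu0 mu0) muL.
have pb : composite_problem X nrm nu mu L M om f h chi gom gf h' by [].
have c0 : 0 < c := rate_gt0 mu0 nu0 muL.
have c1 : c < 1 := rate_lt1 mu0 nu0 muL.
pose r := Num.sqrt c.
have r0 : 0 < r := sqrt_rate_gt0 mu0 nu0 muL.
have r1 : r < 1 := sqrt_rate_lt1 mu0 nu0 muL.
have beta0 : 0 < beta := step_gt0 mu0 nu0 muL.
have bm0 : 0 < beta + mu := addr_gt0 beta0 mu0.
have rk0 k : 0 < r ^+ k by rewrite exprn_gt0.
have T0 : forall k, (0 < T k)%N := inner_length_gt0 mu0 nu0 muL.
have gam01 : 0 <= 1 - c <= 1 by rewrite subr_ge0 (ltW c1) gerBl ltW.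
have pE k t : r ^+ k * (beta * p k t) = beta + mu.
  rewrite /p powR_half ?(ltW c0)// -/r; field.
  by rewrite !gt_eqF.
have thetaE k t : theta k t = (1 - 1 / (1 + r ^+ k)) / (1 - 1 / (1 + r ^+ k) ^+ t).
  by rewrite /theta powR_half ?(ltW c0).
have WE k : W k (T k) = epoch_weight T (fun k => r ^+ k) k.
  by apply: W_coef_geometric.
have orac k t : (1 <= k <= N)%N -> (1 <= t <= T k)%N ->
    unbiased_bounded_variance xi X nrm h' H sigma N T k t.
  by move=> kN tT; have [] := oracle k t kN tT.
pose e := epoch_noise nrm nu mu M h' H xi T xs beta (fun k => r ^+ k) u.
(* The gap contracts by c and each epoch enters with weight 1 - c, so the accumulated noise is again
   a damped sum. *)
pose noise k w := damped (1 - c) (e^~ w) k.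
have A0 : 0 < A.
  have V0 : 0 <= V x0 xs := bregman_ge0 pb Xx0 xs_min.1.
  have D0 : 0 <= Delta0 by rewrite subr_ge0 xs_min.2.
  apply: ltr_wpDl; last first.
    have MS0 : 0 < M ^+ 2 + sigma ^+ 2 by rewrite ltr_pwDl ?exprn_gt0 ?sqr_ge0.
    by rewrite divr_gt0 ?mulr_gt0.
  by rewrite addr_ge0// !mulr_ge0 ?(ltW bm0)//; case/andP: gam01.
have Xrun k w : (k <= N)%N -> X (x k w) /\ X (xb k w).
  exact: (run_in_set pb clX mH orac algo Xx0 xs_min beta0 gam01 rk0 pE thetaE).
have path_bound w : Psi (xb N w) - Psi xs <=
    r ^+ N * (Delta0 + (beta + mu) * (1 - c) * V x0 xs) + noise N w.
  have xb0 : Psi (xb 0%N w) - Psi xs = Delta0 by rewrite (rf_xb0 algo).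
  have x0E : x 0%N w = x0 by rewrite (rf_x0 algo).
  rewrite -xb0 -x0E.
  apply: (outer_telescoping mu0 nu0 muL (S := fun k => Psi (xb k w) - Psi xs)
    (v := fun k => V (x k w) xs) (e := e^~ w)
    (a := fun k => epoch_weight T (fun k => r ^+ k) k / (1 - epoch_weight T (fun k => r ^+ k) k))
    (b := fun k => (1 - epoch_weight T (fun k => r ^+ k) k)^-1)
    (noise := noise^~ w)).
  - exact: horizon_gt0.
  - by move=> k kN; apply: (bregman_ge0 pb) xs_min.1; have [] := Xrun k w kN.
  - by move=> k _; rewrite invr_ge0 ltW// epoch_weight_lt1.
  - by rewrite xb0 subr_ge0 xs_min.2.
  - by [].
  - by move=> k kN; rewrite /noise /= subKr.
  - move=> k kN.
    (* [lexx] because beta is by definition L gam / nu. *)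
    have := outer_descent pb clX mH orac algo Xx0 xs_min beta0 gam01 (lexx _) rk0 T0 pE thetaE w kN.
    by rewrite subKr.
  (* With constant gamma and Gamma_k = c^k, condition (v) is the wanted inequality multiplied by (1
     - c) / c^(k+1). *)
  - move=> k k0; have := weights k.+1 k0; rewrite /Gamma !Gamma_coef_cst !WE.
    have d0 := @epoch_weight_lt1 _ T (fun k => r ^+ k) rk0 T0.
    move: (epoch_weight _ _ k.+1) (d0 k.+1) => W1 d1.
    move: (epoch_weight _ _ k) (d0 k) => W0; rewrite subr_gt0 => d2 hv.
    have pc : 0 < (1 - c) / c ^+ k.+1 by rewrite divr_gt0 ?exprn_gt0 ?subr_gt0.
    have -> : c * ((beta + mu) * (1 - W0)^-1) =
        (1 - c) * (beta + mu) / (c ^+ k * (1 - W0)) / ((1 - c) / c ^+ k.+1).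
      by rewrite exprS; field; rewrite !gt_eqF ?exprn_gt0 ?subr_gt0.
    by rewrite ler_pdivlMr// [leLHS]mulrC mulrAC.
  - exact: first_weight_le.
have noise_bound : mean_le P (noise N)
    (r ^+ N * (2 * (M ^+ 2 + sigma ^+ 2) / (nu * (beta + mu)))).
  set B := (M ^+ 2 + sigma ^+ 2) / (nu * (beta + mu)).
  have B0 : 0 <= B.
    by rewrite divr_ge0 ?addr_ge0 ?sqr_ge0// ltW ?mulr_gt0.
  (* Epoch k has noise level r^k B; the exact solution (1 + r) r^k B bounds the sum, which starts
     from 0, and 1 + r <= 2 gives the factor 2 of A. *)
  have rec k : damped (1 - c) (fun k => r ^+ k * B) k <= (1 + r) * r ^+ k * B.
    elim: k => [|k IH].
      apply: mulr_ge0 => //; apply: mulr_ge0; last exact: ltW (rk0 0%N).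
      by rewrite addr_ge0 ?ler01// ltW.
    rewrite /=.
    rewrite subKr -(noise_recursion mu0 nu0 muL k) [leRHS]mulrDl -(mulrA c) -(mulrA (1 - c)).
    by rewrite lerD2r ler_wpM2l// ltW.
  have eB k : (0 < k <= N)%N -> mean_le P (e k) (r ^+ k * B).
    case: k => // k /= kN.
    have := epoch_noise_mean_le pb clX mH orac algo Xx0 xs_min beta0 gam01 rk0 T0 pE thetaE kN.
    apply: mean_leW; rewrite le_eqVlt; apply/orP; left; apply/eqP.
    by rewrite /B; field; rewrite !gt_eqF.
  apply: mean_leW (mean_le_damped gam01 eB).
  apply: (le_trans (rec N)).
  have -> : r ^+ N * (2 * (M ^+ 2 + sigma ^+ 2) / (nu * (beta + mu))) = 2 * r ^+ N * B.
    by rewrite -[2 * _ / _]mulrA -/B (mulrCA _ 2) mulrA.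
  apply: (ler_wpM2r B0); apply: (ler_wpM2r (ltW (rk0 N))).
  by rewrite lerD2l ltW.
have mean_bound : ('E_P[fun w => (Psi (xb N w) - Psi xs)%R] <= (r ^+ N * A)%:E)%E.
  rewrite unlock; have [_ hN] := mean_leD (mean_le_cst P
    (r ^+ N * (Delta0 + (beta + mu) * (1 - c) * V x0 xs))) noise_bound.
  rewrite -mulrDr in hN; apply: le_trans hN.
  apply: le_integral_ge0 => w; last exact: path_bound.
  by rewrite subr_ge0 xs_min.2//; have [] := Xrun N w (leqnn _).
split.
- by rewrite powR_half ?(ltW c0).
- apply: (le_trans mean_bound); rewrite lee_fin.
  exact: horizon_accuracy.
- rewrite gradient_evaluationsE (mulrC nu) maxC.
  exact: gradient_complexity.
- rewrite (mulrC nu) maxC => epsA.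
  exact: oracle_complexity.
Qed.
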